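(* Let $\gamma\ge1$, $\mu>0$, $k>0$, $\epsilon>0$. Suppose the end states $[\rho^{\pm},u^{\pm}]$ and the speed $s\in\mathbb{R}$ satisfy $\rho^{\pm}>0$ and $[\rho^{\pm},u^{\pm};s]$ defines, for the system $\rho_t+(\rho u)_x=0$, $u_t+\frac{(u^2)_x}{2}+(h(\rho))_x=0$, either (i) a Lax 2-shock with a subsonic right state $[\rho^+,u^+]$; or (ii) a Lax 1-shock with a subsonic left state $[\rho^-,u^-]$. Then there exists a traveling wave profile, with speed $s$, connecting $[\rho^-,u^-]$ to $[\rho^+,u^+]$ for the system $$\rho_t+(\rho u)_x=0,$$ $$u_t+\frac{(u^2)_x}{2}+(h(\rho))_x=\epsilon\mu\Big(\frac{(\rho u)_x}{\rho}\Big)_x+\epsilon^2k^2\Big(\frac{(\sqrt{\rho})_{xx}}{\sqrt{\rho}}\Big)_x .$$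
   Context: The enthalpy is $h(\rho)=\ln\rho$ if $\gamma=1$ and $h(\rho)=\frac{\gamma}{\gamma-1}\rho^{\gamma-1}$ if $\gamma>1$. The sound speed is $c_s(\rho)=\sqrt{\rho h'(\rho)}$. For $W=[\rho,u]$ the eigenvalues of the Jacobian of the system $\rho_t+(\rho u)_x=0$, $u_t+\frac{(u^2)_x}{2}+(h(\rho))_x=0$ are $\lambda_1(W)=u-c_s(\rho)$ and $\lambda_2(W)=u+c_s(\rho)$. With $W^\pm=[\rho^\pm,u^\pm]$, the triple $(W^\pm,s)$ is a Lax $j$-shock ($j=1,2$) if it satisfies the Rankine--Hugoniot conditions $$s(\rho^+-\rho^-)=\rho^+u^+-\rho^-u^-,\qquad s(u^+-u^-)=\Big(\tfrac{(u^+)^2}{2}+h(\rho^+)\Big)-\Big(\tfrac{(u^-)^2}{2}+h(\rho^-)\Big),$$ and $\lambda_j(W^+)<s<\lambda_j(W^-)$. The state $[\rho^\pm,u^\pm]$ is called subsonic if $|u^\pm|<c_s(\rho^\pm)$. A traveling wave profile with speed $s$ connecting $[\rho^-,u^-]$ to $[\rho^+,u^+]$ is a pair of smooth functions $P,U:\mathbb{R}\to\mathbb{R}$ with $P>0$ such that $$\rho(t,x)=P\Big(\frac{x-st}{\epsilon}\Big)^2,\qquad u(t,x)=U\Big(\frac{x-st}{\epsilon}\Big)$$ solves the system with viscosity and dispersion, and $\lim_{y\to\pm\infty}P(y)^2=\rho^\pm$, $\lim_{y\to\pm\infty}U(y)=u^\pm$. *)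

(* Defs.v *)
From Stdlib Require Import Reals.
From Coquelicot Require Import Coquelicot.
Open Scope R_scope.

Record state := State { density : R; velocity : R }.

(* Only evaluated at [rho > 0], where [Rpower] is the real power. *)
Definition enthalpy (gamma rho : R) : R :=
  if Req_EM_T gamma 1 then ln rho
  else gamma / (gamma - 1) * Rpower rho (gamma - 1).

Definition sound_speed (gamma rho : R) : R :=
  sqrt (rho * Derive (enthalpy gamma) rho).

Inductive family := family1 | family2.

Definition eigenvalue (gamma : R) (j : family) (W : state) : R :=
  match j with
  | family1 => velocity W - sound_speed gamma (density W)
  | family2 => velocity W + sound_speed gamma (density W)
  end.

Definition rankine_hugoniot (gamma : R) (Wm Wp : state) (s : R) : Prop :=
  s * (density Wp - density Wm)
    = density Wp * velocity Wp - density Wm * velocity Wm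
  /\
  s * (velocity Wp - velocity Wm)
    = (velocity Wp ^ 2 / 2 + enthalpy gamma (density Wp))
      - (velocity Wm ^ 2 / 2 + enthalpy gamma (density Wm)).

Definition lax_shock (gamma : R) (j : family) (Wm Wp : state) (s : R) : Prop :=
  rankine_hugoniot gamma Wm Wp s
  /\ eigenvalue gamma j Wp < s < eigenvalue gamma j Wm.

Definition subsonic (gamma : R) (W : state) : Prop :=
  Rabs (velocity W) < sound_speed gamma (density W).

Definition smooth (f : R -> R) : Prop :=
  forall (n : nat) (x : R), ex_derive_n f n x.

(* [rho] and [u] are functions of [t] and [x], in this order. [Derive] is total
   and carries no differentiability claim; the predicate is only applied to
   smooth [rho > 0] and [u], for which all the derivatives below exist. *)
Definition solves_viscous_dispersive_system
    (gamma mu k eps : R) (rho u : R -> R -> R) : Prop :=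
  forall t x : R,
    Derive (fun t' => rho t' x) t + Derive (fun x' => rho t x' * u t x') x = 0
    /\
    Derive (fun t' => u t' x) t
      + Derive (fun x' => u t x' ^ 2) x / 2
      + Derive (fun x' => enthalpy gamma (rho t x')) x
    = eps * mu
        * Derive (fun x' =>
            Derive (fun x'' => rho t x'' * u t x'') x' / rho t x') x
      + eps ^ 2 * k ^ 2
        * Derive (fun x' =>
            Derive_n (fun x'' => sqrt (rho t x'')) 2 x' / sqrt (rho t x')) x.

Definition traveling_wave_profile
    (gamma mu k eps s : R) (Wm Wp : state) (P U : R -> R) : Prop :=
  smooth P /\ smooth U /\ (forall y : R, 0 < P y)
  /\ solves_viscous_dispersive_system gamma mu k eps
       (fun t x => P ((x - s * t) / eps) ^ 2)
       (fun t x => U ((x - s * t) / eps))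
  /\ is_lim (fun y => P y ^ 2) m_infty (Finite (density Wm))
  /\ is_lim (fun y => P y ^ 2) p_infty (Finite (density Wp))
  /\ is_lim U m_infty (Finite (velocity Wm))
  /\ is_lim U p_infty (Finite (velocity Wp)).

(* Main.v *)
Require Import Defs.
From Stdlib Require Import Reals Lra Lia Classical.
From Coquelicot Require Import Coquelicot.
Open Scope R_scope.

(** For a wave of the variable y = (x - s t) / eps, conservation of mass reads
    rho (u - s) = A with a constant A, so u = s + A / rho. Substituting this in
    the momentum equation and integrating once, the amplitude P = sqrt rho obeys

      k^2 P'' + 2 mu s P' = P g(P^2),   g(rho) = A^2 / (2 rho^2) + h(rho) - B,

    a nonlinear oscillator with friction coefficient 2 mu s. The
    Rankine-Hugoniot conditions say exactly that A and B are the same at both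
    end states and that g vanishes there. The Lax inequalities say that the flow
    relative to the shock is supersonic at one end and subsonic at the other;
    since rho^3 g'(rho) = gamma rho^(gamma+1) - A^2 increases, g is negative
    between the two densities and positive elsewhere, and the supersonic density
    is the smaller one. Its amplitude a is therefore the bottom of the well of
    the potential V with V' = -P g(P^2) / k^2, while the amplitude b > a of the
    subsonic end is a local maximum of V, that is, a saddle of the phase plane.

    For a 2-shock with subsonic right state s is positive, so the friction is
    dissipative, the saddle lies at -oo and the well at +oo. For a 1-shock with
    subsonic left state s is negative, and reversing y gives the same situation.
    It remains to connect the saddle to the well (damped_heteroclinic).

    Near the saddle, a shooting argument in reversed time replaces the stable
    manifold theorem (saddle_trajectory): among the trajectories that start from
    a fixed position between a and b, those that ever fall below this position
    and those that ever rise above b form two disjoint open sets of initial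
    velocities, so some velocity belongs to neither. Its trajectory is trapped
    and cannot rise again after a descent; hence it converges, and the only
    possible limit is b.

    In forward time the energy P'^2 / 2 + V(P) decreases strictly from V(b). It
    therefore keeps P below b, and away from vacuum, because A <> 0 makes V
    tend to +oo at 0. The energy converges, so Barbalat's lemma yields P' -> 0,
    a second use of it yields P'' -> 0, and the only rest point left is a
    (forward_limit).

    Both arguments live on a compact range of P, where the force may be
    truncated to a globally Lipschitz one; global existence then comes from
    Picard iteration and continuous dependence from Gronwall's inequality. *)

(** * Calculus on the line *)

Lemma is_derive_continuous (f : R -> R) x l : is_derive f x l -> continuous f x.
Proof. intros H; apply (ex_derive_continuous f); now exists l. Qed.

Lemma mean_value (f f' : R -> R) a b :
  a <= b -> (forall x, a <= x <= b -> is_derive f x (f' x)) ->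
  exists c, a <= c <= b /\ f b - f a = f' c * (b - a).
Proof.
intros Hab Hf.
destruct (MVT_gen f a b f') as [c [Hc E]].
- rewrite Rmin_left, Rmax_right by lra. intros x Hx; apply Hf; lra.
- rewrite Rmin_left, Rmax_right by lra. intros x Hx.
  apply continuity_pt_filterlim, (is_derive_continuous f x (f' x)), Hf; lra.
- rewrite Rmin_left, Rmax_right in Hc by lra. now exists c.
Qed.

Lemma nonneg_derivative_le (f f' : R -> R) a b :
  a <= b -> (forall x, a <= x <= b -> is_derive f x (f' x)) ->
  (forall x, a <= x <= b -> 0 <= f' x) -> f a <= f b.
Proof.
intros Hab Hf Hpos. destruct (mean_value f f' a b Hab Hf) as [c [Hc E]].
specialize (Hpos c Hc). nra.
Qed.

Lemma bounded_derivative_lipschitz (f f' : R -> R) T K :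
  (forall t, T <= t -> is_derive f t (f' t)) ->
  (forall t, T <= t -> Rabs (f' t) <= K) ->
  forall s t, T <= s -> T <= t -> Rabs (f s - f t) <= K * Rabs (s - t).
Proof.
intros Hf HK.
assert (W : forall s t, T <= s -> s <= t -> Rabs (f s - f t) <= K * Rabs (s - t)).
{ intros s t Hs Hst.
  destruct (mean_value f f' s t Hst) as [c [Hc E]].
  { intros x Hx; apply Hf; lra. }
  rewrite <- (Rabs_Ropp (f s - f t)), <- (Rabs_Ropp (s - t)), !Ropp_minus_distr, E, Rabs_mult.
  apply Rmult_le_compat_r; [apply Rabs_pos | apply HK; lra]. }
intros s t Hs Ht. destruct (Rle_dec s t).
- apply W; lra.
- rewrite Rabs_minus_sym, (Rabs_minus_sym s). apply W; lra.
Qed.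

(** A weight exp (Lam |t|) reproduces itself under integration, with the
    gain 1 / Lam; this turns Picard iteration on the whole line into a
    contraction without splitting the time axis. *)
Lemma exp_growth_bound (D d : R -> R) K Lam :
  0 < Lam -> 0 <= K -> D 0 = 0 -> (forall t, is_derive D t (d t)) ->
  (forall t, Rabs (d t) <= K * exp (Lam * Rabs t)) ->
  forall t, Rabs (D t) <= K / Lam * exp (Lam * Rabs t).
Proof.
intros HL HK H0 HD Hd.
assert (W : forall E e, E 0 = 0 -> (forall t, is_derive E t (e t)) ->
   (forall t, 0 <= t -> e t <= K * exp (Lam * t)) ->
   forall t, 0 <= t -> E t <= K / Lam * exp (Lam * t)).
{ intros E e HE0 HE He t Ht.
  assert (H := nonneg_derivative_le (fun t => K / Lam * exp (Lam * t) - E t)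
    (fun t => K * exp (Lam * t) - e t) 0 t Ht).
  cbv beta in H. rewrite HE0, Rmult_0_r, exp_0 in H.
  assert (0 <= K / Lam) by (apply Rdiv_le_0_compat; lra).
  assert (K / Lam * 1 - 0 <= K / Lam * exp (Lam * t) - E t); [|lra].
  apply H.
  - intros x _. auto_derive. { now exists (e x). }
    replace (Derive (fun x => E x) x) with (e x) by (symmetry; apply is_derive_unique, HE). field; lra.
  - intros x Hx. specialize (He x); lra. }
intros t. destruct (Rle_dec 0 t) as [Ht|Ht].
- rewrite (Rabs_pos_eq t) by lra. apply Rabs_le; split.
  + enough (- D t <= K / Lam * exp (Lam * t)) by lra.
    apply (W (fun t => - D t) (fun t => - d t)); trivial. { rewrite H0; ring. }
    { intros x; apply (is_derive_opp D x (d x)), HD. }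
    intros x Hx. specialize (Hd x). rewrite (Rabs_pos_eq x) in Hd by lra.
    apply Rabs_le_between in Hd; lra.
  + apply (W D d); trivial.
    intros x Hx. specialize (Hd x). rewrite (Rabs_pos_eq x) in Hd by lra.
    apply Rabs_le_between in Hd; lra.
- rewrite (Rabs_left t) by lra.
  assert (HR : forall x, is_derive (fun t => D (- t)) x (- d (- x))).
  { intros x. auto_derive. { now exists (d (- x)). }
    replace (Derive (fun x => D x) (- x)) with (d (- x)) by (symmetry; apply is_derive_unique, HD). ring. }
  replace t with (- - t) at 1 by ring.
  apply Rabs_le; split.
  + enough (- D (- - t) <= K / Lam * exp (Lam * - t)) by lra.
    apply (W (fun t => - D (- t)) (fun t => - - d (- t))); try lra.
    { rewrite Ropp_0, H0; ring. }
    { intros x; apply (is_derive_opp (fun t => D (- t)) x (- d (- x))), HR. }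
    intros x Hx. specialize (Hd (- x)). rewrite Rabs_Ropp, (Rabs_pos_eq x) in Hd by lra.
    apply Rabs_le_between in Hd; lra.
  + apply (W (fun t => D (- t)) (fun t => - d (- t))); try lra.
    { rewrite Ropp_0, H0; ring. } { exact HR. }
    intros x Hx. specialize (Hd (- x)). rewrite Rabs_Ropp, (Rabs_pos_eq x) in Hd by lra.
    apply Rabs_le_between in Hd; lra.
Qed.

(** * Global Picard iteration and Gronwall's inequality *)

Section Picard.
Variables (f g : R -> R -> R) (L : R).
Hypothesis L_pos : 0 < L.
Definition lipschitz_pair (f : R -> R -> R) := forall a b a' b',
  Rabs (f a b - f a' b') <= L * (Rabs (a - a') + Rabs (b - b')).
Hypothesis f_lip : lipschitz_pair f.
Hypothesis g_lip : lipschitz_pair g.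
Variables x0 y0 : R.

Lemma lipschitz_pair_continuous (h : R -> R -> R) (x y : R -> R) t :
  lipschitz_pair h -> continuous x t -> continuous y t ->
  continuous (fun t => h (x t) (y t)) t.
Proof.
intros Hh Hx Hy. apply continuity_pt_filterlim.
apply continuity_pt_filterlim in Hx. apply continuity_pt_filterlim in Hy.
intros e He. assert (He' : 0 < e / (2 * L)) by (apply Rdiv_lt_0_compat; lra).
destruct (Hx _ He') as [d1 [Hd1 H1]]. destruct (Hy _ He') as [d2 [Hd2 H2]].
exists (Rmin d1 d2). split. { now apply Rmin_glb_lt. }
intros z [Hz1 Hz2]. simpl in *. unfold R_dist in *.
assert (Rabs (x z - x t) < e / (2 * L)).
{ apply H1; split; trivial. eapply Rlt_le_trans; [apply Hz2 | apply Rmin_l]. }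
assert (Rabs (y z - y t) < e / (2 * L)).
{ apply H2; split; trivial. eapply Rlt_le_trans; [apply Hz2 | apply Rmin_r]. }
eapply Rle_lt_trans; [apply Hh|].
replace e with (L * (e / (2 * L) + e / (2 * L))) by (field; lra).
apply Rmult_lt_compat_l; lra.
Qed.

Fixpoint picard (n : nat) : (R -> R) * (R -> R) :=
  match n with
  | O => (fun _ => x0, fun _ => y0)
  | S n => (fun t => x0 + RInt (fun r => f (fst (picard n) r) (snd (picard n) r)) 0 t,
            fun t => y0 + RInt (fun r => g (fst (picard n) r) (snd (picard n) r)) 0 t)
  end.

Lemma is_derive_primitive (h : R -> R) c t :
  (forall r, continuous h r) -> is_derive (fun t => c + RInt h 0 t) t (h t).
Proof.
intros Hh. replace (h t) with (0 + h t) by ring.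
apply (is_derive_plus (fun _ => c)).
{ apply (is_derive_const c t). }
apply (is_derive_RInt h _ 0).
- exists (mkposreal 1 Rlt_0_1). intros y _. apply (RInt_correct h).
  apply (ex_RInt_continuous h); intros; apply Hh.
- apply Hh.
Qed.

Lemma picard_continuous n t :
  continuous (fst (picard n)) t /\ continuous (snd (picard n)) t.
Proof.
revert t; induction n; intros t; simpl.
- split; apply continuous_const.
- split; eapply is_derive_continuous; apply is_derive_primitive; intros r;
    apply lipschitz_pair_continuous; trivial; apply IHn.
Qed.

Lemma picard_derive n t :
  is_derive (fst (picard (S n))) t (f (fst (picard n) t) (snd (picard n) t)) /\
  is_derive (snd (picard (S n))) t (g (fst (picard n) t) (snd (picard n) t)).
Proof.
split; simpl.
- apply (is_derive_primitive (fun r => f (fst (picard n) r) (snd (picard n) r))).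
  intros r; apply lipschitz_pair_continuous; trivial; apply picard_continuous.
- apply (is_derive_primitive (fun r => g (fst (picard n) r) (snd (picard n) r))).
  intros r; apply lipschitz_pair_continuous; trivial; apply picard_continuous.
Qed.

Lemma picard_0 n : fst (picard n) 0 = x0 /\ snd (picard n) 0 = y0.
Proof. destruct n; simpl; split; trivial; rewrite RInt_point; apply Rplus_0_r. Qed.

Let Lam := 4 * L.
Let M := (Rabs (f x0 y0) + Rabs (g x0 y0)) / Lam.

(** With Lam = 4 L, integration divides the weight by 4 L while the
    Lipschitz bound multiplies by 2 L: each step gains a factor 1/2. *)
Lemma picard_step n t :
  Rabs (fst (picard (S n)) t - fst (picard n) t) <= M * (1/2)^n * exp (Lam * Rabs t) /\
  Rabs (snd (picard (S n)) t - snd (picard n) t) <= M * (1/2)^n * exp (Lam * Rabs t).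
Proof.
assert (HLam : 0 < Lam) by (unfold Lam; lra).
assert (HM : 0 <= M).
{ apply Rdiv_le_0_compat; trivial. assert (H := Rabs_pos (f x0 y0)).
  assert (H' := Rabs_pos (g x0 y0)). lra. }
revert t; induction n; intros t.
- assert (W : forall (h : R -> R -> R) z, lipschitz_pair h ->
    Rabs (h x0 y0) <= Rabs (f x0 y0) + Rabs (g x0 y0) ->
    z 0 = 0 -> (forall t, is_derive z t (h x0 y0)) ->
    Rabs (z t) <= M * (1/2)^0 * exp (Lam * Rabs t)).
  { intros h z _ Hh Hz0 Hz. rewrite pow_O, Rmult_1_r. unfold M.
    apply (exp_growth_bound z (fun _ => h x0 y0)); trivial.
    { eapply Rle_trans; [|apply Hh]. apply Rabs_pos. }
    intros r. assert (1 <= exp (Lam * Rabs r)).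
    { rewrite <- exp_0. assert (H := Rabs_pos r).
      destruct (Rle_lt_or_eq_dec 0 (Lam * Rabs r)) as [E|E]; [nra| |].
      - left; now apply exp_increasing.
      - rewrite <- E; lra. }
    assert (H1 := Rabs_pos (h x0 y0)). nra. }
  assert (Hf := Rabs_pos (f x0 y0)). assert (Hg := Rabs_pos (g x0 y0)).
  destruct (picard_0 1) as [E1 E2].
  split.
  + apply (W f (fun t => fst (picard 1) t - fst (picard 0) t)); trivial; try lra.
    { rewrite E1; simpl; ring. }
    intros r. replace (f x0 y0) with (f x0 y0 - 0) by ring.
    apply (is_derive_minus (fst (picard 1)) (fun _ => x0)).
    apply (picard_derive 0). apply (is_derive_const x0 r).
  + apply (W g (fun t => snd (picard 1) t - snd (picard 0) t)); trivial; try lra.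
    { rewrite E2; simpl; ring. }
    intros r. replace (g x0 y0) with (g x0 y0 - 0) by ring.
    apply (is_derive_minus (snd (picard 1)) (fun _ => y0)).
    apply (picard_derive 0). apply (is_derive_const y0 r).
- assert (W : forall (h : R -> R -> R) z, lipschitz_pair h ->
    z 0 = 0 -> (forall t, is_derive z t
      (h (fst (picard (S n)) t) (snd (picard (S n)) t) - h (fst (picard n) t) (snd (picard n) t))) ->
    Rabs (z t) <= M * (1/2)^(S n) * exp (Lam * Rabs t)).
  { intros h z Hh Hz0 Hz.
    assert (Hp : 0 <= (1/2)^n) by (apply pow_le; lra).
    replace (M * (1/2)^(S n)) with (2 * L * M * (1/2)^n / Lam).
    2:{ simpl. unfold Lam. field. lra. }
    eapply exp_growth_bound; trivial.
    { apply Rmult_le_pos; trivial. apply Rmult_le_pos; trivial; lra. }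
    { exact Hz. }
    intros r. eapply Rle_trans. { apply Hh. }
    destruct (IHn r) as [H1 H2]. 
    replace (2 * L * M * (1/2)^n * exp (Lam * Rabs r)) with
      (L * (M * (1/2)^n * exp (Lam * Rabs r) + M * (1/2)^n * exp (Lam * Rabs r))) by ring.
    apply Rmult_le_compat_l; lra. }
  destruct (picard_0 (S (S n))) as [E1 E2]. destruct (picard_0 (S n)) as [E3 E4].
  split.
  + apply (W f (fun t => fst (picard (S (S n))) t - fst (picard (S n)) t)); trivial.
    { rewrite E1, E3; ring. }
    intros r. apply (is_derive_minus (fst (picard (S (S n)))) (fst (picard (S n)))); apply picard_derive.
  + apply (W g (fun t => snd (picard (S (S n))) t - snd (picard (S n)) t)); trivial.
    { rewrite E2, E4; ring. }
    intros r. apply (is_derive_minus (snd (picard (S (S n)))) (snd (picard (S n)))); apply picard_derive.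
Qed.
End Picard.

Lemma geometric_limit (u : nat -> R) C :
  0 <= C -> (forall n, Rabs (u (S n) - u n) <= C * (1/2)^n) ->
  forall n, Rabs (real (Lim_seq u) - u n) <= 2 * C * (1/2)^n.
Proof.
intros HC Hu.
assert (W : forall n k, Rabs (u (n + k)%nat - u n) <= 2 * C * ((1/2)^n - (1/2)^(n+k))).
{ intros n k; induction k.
  - rewrite Nat.add_0_r, !Rminus_diag, Rabs_R0; lra.
  - replace (u (n + S k)%nat - u n) with ((u (S (n + k)) - u (n + k)%nat) + (u (n + k)%nat - u n)).
    2:{ rewrite Nat.add_succ_r; ring. }
    eapply Rle_trans; [apply Rabs_triang|]. specialize (Hu (n + k)%nat).
    rewrite Nat.add_succ_r. simpl pow. lra. }
assert (W' : forall n m, (n <= m)%nat -> Rabs (u m - u n) <= 2 * C * (1/2)^n).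
{ intros n m Hm. replace m with (n + (m - n))%nat by lia. eapply Rle_trans; [apply W|].
  assert (0 <= (1/2)^(n + (m - n))) by (apply pow_le; lra). nra. }
assert (HL : is_lim_seq u (real (Lim_seq u))).
{ apply Lim_seq_correct', ex_lim_seq_cauchy_corr.
  intros e. assert (He : 0 < e / (4 * C + 1)). { apply Rdiv_lt_0_compat; [apply cond_pos | lra]. }
  assert (Hlt : Rabs (1/2) < 1) by (rewrite Rabs_pos_eq; lra).
  destruct (pow_lt_1_zero (1/2) Hlt _ He) as [N HN].
  exists N. intros n m Hn Hm.
  specialize (HN N (Nat.le_refl _)). rewrite Rabs_pos_eq in HN by (apply pow_le; lra).
  assert (H1 := W' N n Hn). assert (H2 := W' N m Hm).
  assert (H3 : (4 * C + 1) * (1/2)^N < e).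
  { replace (pos e) with ((4 * C + 1) * (e / (4 * C + 1))) by (field; lra).
    apply Rmult_lt_compat_l; lra. }
  assert (H4 : 0 <= (1/2)^N) by (apply pow_le; lra).
  replace (u n - u m) with ((u n - u N) - (u m - u N)) by ring.
  eapply Rle_lt_trans; [apply Rabs_triang|]. rewrite Rabs_Ropp. lra. }
intros n.
assert (HL' : is_lim_seq (fun m => Rabs (u (m + n)%nat - u n)) (Rabs (real (Lim_seq u) - u n))).
{ apply (is_lim_seq_abs (fun m => u (m + n)%nat - u n) (real (Lim_seq u) - u n)).
  apply (is_lim_seq_minus' (fun m => u (m + n)%nat) (fun _ => u n)).
  - now apply (is_lim_seq_incr_n u n).
  - apply is_lim_seq_const. }
apply (is_lim_seq_le (fun m => Rabs (u (m + n)%nat - u n)) (fun _ => 2 * C * (1/2)^n)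
  (Rabs (real (Lim_seq u) - u n)) (2 * C * (1/2)^n)); trivial.
- intros m. apply W'; lia.
- apply is_lim_seq_const.
Qed.

Lemma geometric_small C e : 0 <= C -> 0 < e -> exists n, C * (1/2)^n < e.
Proof.
intros HC He.
assert (He' : 0 < e / (C + 1)) by (apply Rdiv_lt_0_compat; lra).
assert (Hlt : Rabs (1/2) < 1) by (rewrite Rabs_pos_eq; lra).
destruct (pow_lt_1_zero (1/2) Hlt _ He') as [N HN]. exists N.
specialize (HN N (Nat.le_refl _)). assert (Hp : 0 <= (1/2)^N) by (apply pow_le; lra).
rewrite Rabs_pos_eq in HN by trivial.
replace e with ((C + 1) * (e / (C + 1))) by (field; lra). nra.
Qed.

Lemma geometric_limit_continuous (u : nat -> R -> R) (U : R -> R) C Lam :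
  0 <= C -> 0 < Lam -> (forall n t, continuous (u n) t) ->
  (forall n t, Rabs (U t - u n t) <= C * exp (Lam * Rabs t) * (1/2)^n) ->
  forall t, continuous U t.
Proof.
intros HC HLam Hu HU t. apply continuity_pt_filterlim. intros e He.
assert (He3 : 0 < e / 3) by lra.
destruct (geometric_small (C * exp (Lam * (Rabs t + 1))) (e / 3)) as [n Hn]; trivial.
{ apply Rmult_le_pos; trivial. left; apply exp_pos. }
assert (Hc := Hu n t). apply continuity_pt_filterlim in Hc.
destruct (Hc _ He3) as [d [Hd H]].
exists (Rmin d 1). split. { apply Rmin_glb_lt; lra. }
intros z [Hz1 Hz2]. simpl in *. unfold R_dist in *.
assert (Hd1 : Rabs (z - t) < d) by (eapply Rlt_le_trans; [apply Hz2 | apply Rmin_l]).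
assert (Hd2 : Rabs (z - t) < 1) by (eapply Rlt_le_trans; [apply Hz2 | apply Rmin_r]).
assert (Hb : forall r, Rabs r <= Rabs t + 1 -> Rabs (U r - u n r) < e / 3).
{ intros r Hr. eapply Rle_lt_trans; [apply HU|]. eapply Rle_lt_trans; [|apply Hn].
  apply Rmult_le_compat_r; [apply pow_le; lra|]. apply Rmult_le_compat_l; trivial.
  destruct (Rle_lt_or_eq_dec (Rabs r) (Rabs t + 1) Hr) as [E|E].
  - left; apply exp_increasing. nra.
  - rewrite E; lra. }
assert (Rabs (U z - u n z) < e / 3).
{ apply Hb. replace z with ((z - t) + t) by ring.
  eapply Rle_trans; [apply Rabs_triang|]. lra. }
assert (Rabs (U t - u n t) < e / 3) by (apply Hb; lra).
assert (Rabs (u n z - u n t) < e / 3) by (apply H; split; trivial).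
replace (U z - U t) with ((U z - u n z) + (u n z - u n t) - (U t - u n t)) by ring.
apply Rabs_lt_between in H0, H1, H2. apply Rabs_lt_between. lra.
Qed.

(** The limits X, Y of the iterates satisfy the integral equation because its
    right-hand side, evaluated at X and Y, is within a geometric error of the
    next iterate. *)
Lemma global_solution (f g : R -> R -> R) L x0 y0 :
  0 < L -> lipschitz_pair L f -> lipschitz_pair L g ->
  exists x y : R -> R, x 0 = x0 /\ y 0 = y0 /\
    forall t, is_derive x t (f (x t) (y t)) /\ is_derive y t (g (x t) (y t)).
Proof.
intros HL Hf Hg.
set (X := fun t => real (Lim_seq (fun n => fst (picard f g x0 y0 n) t))).
set (Y := fun t => real (Lim_seq (fun n => snd (picard f g x0 y0 n) t))).
set (M := (Rabs (f x0 y0) + Rabs (g x0 y0)) / (4 * L)).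
assert (HM : 0 <= M).
{ apply Rdiv_le_0_compat; [|lra]. assert (H := Rabs_pos (f x0 y0)).
  assert (H' := Rabs_pos (g x0 y0)). lra. }
assert (HX : forall n t, Rabs (X t - fst (picard f g x0 y0 n) t)
              <= 2 * M * exp (4 * L * Rabs t) * (1/2)^n).
{ intros n t. replace (2 * M * exp (4 * L * Rabs t)) with (2 * (M * exp (4 * L * Rabs t))) by ring.
  apply (geometric_limit (fun n => fst (picard f g x0 y0 n) t)).
  - apply Rmult_le_pos; trivial. left; apply exp_pos.
  - intros m. destruct (picard_step f g L HL Hf Hg x0 y0 m t) as [H _]. fold M in H. lra. }
assert (HY : forall n t, Rabs (Y t - snd (picard f g x0 y0 n) t)
              <= 2 * M * exp (4 * L * Rabs t) * (1/2)^n).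
{ intros n t. replace (2 * M * exp (4 * L * Rabs t)) with (2 * (M * exp (4 * L * Rabs t))) by ring.
  apply (geometric_limit (fun n => snd (picard f g x0 y0 n) t)).
  - apply Rmult_le_pos; trivial. left; apply exp_pos.
  - intros m. destruct (picard_step f g L HL Hf Hg x0 y0 m t) as [_ H]. fold M in H. lra. }
clearbody X Y M.
assert (cX : forall t, continuous X t).
{ apply (geometric_limit_continuous (fun n => fst (picard f g x0 y0 n)) X (2 * M) (4 * L));
    trivial; try lra. intros n t; now apply (picard_continuous f g L). }
assert (cY : forall t, continuous Y t).
{ apply (geometric_limit_continuous (fun n => snd (picard f g x0 y0 n)) Y (2 * M) (4 * L));
    trivial; try lra. intros n t; now apply (picard_continuous f g L). }
assert (W : forall h z0 (z : nat -> R -> R) Z, lipschitz_pair L h ->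
   (forall n, z n 0 = z0) ->
   (forall n t, is_derive (z (S n)) t
     (h (fst (picard f g x0 y0 n) t) (snd (picard f g x0 y0 n) t))) ->
   (forall n t, Rabs (Z t - z n t) <= 2 * M * exp (4 * L * Rabs t) * (1/2)^n) ->
   forall t, z0 + RInt (fun r => h (X r) (Y r)) 0 t = Z t).
{ intros h z0 z Z Hh Hz0 Hz HZ t.
  assert (B : forall n, Rabs (z0 + RInt (fun r => h (X r) (Y r)) 0 t - z (S n) t)
              <= M * (1/2)^n * exp (4 * L * Rabs t)).
  { intros n. replace (M * (1/2)^n) with (4 * L * M * (1/2)^n / (4 * L)) by (field; lra).
    assert (Hp : 0 <= (1/2)^n) by (apply pow_le; lra).
    apply (exp_growth_bound
      (fun t => z0 + RInt (fun r => h (X r) (Y r)) 0 t - z (S n) t)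
      (fun t => h (X t) (Y t) - h (fst (picard f g x0 y0 n) t) (snd (picard f g x0 y0 n) t))).
    - lra.
    - apply Rmult_le_pos; trivial. apply Rmult_le_pos; trivial; lra.
    - rewrite RInt_point, Hz0. apply Rminus_diag_eq, Rplus_0_r.
    - intros r. apply (is_derive_minus (fun t => z0 + RInt (fun r => h (X r) (Y r)) 0 t) (z (S n))).
      + apply (is_derive_primitive (fun r => h (X r) (Y r))).
        intros q; now apply (lipschitz_pair_continuous L).
      + apply Hz.
    - intros r. eapply Rle_trans; [apply Hh|].
      specialize (HX n r). specialize (HY n r).
      replace (4 * L * M * (1/2)^n * exp (4 * L * Rabs r)) with
        (L * (2 * M * exp (4 * L * Rabs r) * (1/2)^n + 2 * M * exp (4 * L * Rabs r) * (1/2)^n)) by ring.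
      apply Rmult_le_compat_l; lra. }
  set (E := z0 + RInt (fun r => h (X r) (Y r)) 0 t) in *. clearbody E.
  destruct (Req_dec E (Z t)) as [H|H]; trivial. exfalso.
  assert (He : 0 < Rabs (E - Z t)) by (apply Rabs_pos_lt; lra).
  destruct (geometric_small (2 * M * exp (4 * L * Rabs t)) (Rabs (E - Z t)) ) as [n Hn]; trivial.
  { apply Rmult_le_pos; [lra | left; apply exp_pos]. }
  specialize (B n). specialize (HZ (S n) t). simpl pow in HZ.
  replace (E - Z t) with ((E - z (S n) t) - (Z t - z (S n) t)) in Hn by ring.
  assert (T := Rabs_triang (E - z (S n) t) (- (Z t - z (S n) t))).
  rewrite Rabs_Ropp in T. unfold Rminus at 1 in Hn. lra. }
assert (EX := W f x0 (fun n => fst (picard f g x0 y0 n)) X Hf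
  (fun n => proj1 (picard_0 f g x0 y0 n))
  (fun n t => proj1 (picard_derive f g L HL Hf Hg x0 y0 n t)) HX).
assert (EY := W g y0 (fun n => snd (picard f g x0 y0 n)) Y Hg
  (fun n => proj2 (picard_0 f g x0 y0 n))
  (fun n t => proj2 (picard_derive f g L HL Hf Hg x0 y0 n t)) HY).
exists X, Y. split; [|split].
- rewrite <- EX, RInt_point. apply Rplus_0_r.
- rewrite <- EY, RInt_point. apply Rplus_0_r.
- intros t. split.
  + apply (is_derive_ext _ _ _ _ EX), (is_derive_primitive (fun r => f (X r) (Y r))).
    intros r; now apply (lipschitz_pair_continuous L).
  + apply (is_derive_ext _ _ _ _ EY), (is_derive_primitive (fun r => g (X r) (Y r))).
    intros r; now apply (lipschitz_pair_continuous L).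
Qed.

(** The squared distance N of two solutions satisfies N' <= 4 L N. *)
Lemma gronwall (f g : R -> R -> R) L (x y x' y' : R -> R) :
  0 < L -> lipschitz_pair L f -> lipschitz_pair L g ->
  (forall t, 0 <= t -> is_derive x t (f (x t) (y t)) /\ is_derive y t (g (x t) (y t))) ->
  (forall t, 0 <= t -> is_derive x' t (f (x' t) (y' t)) /\ is_derive y' t (g (x' t) (y' t))) ->
  forall t, 0 <= t ->
  (x t - x' t)^2 + (y t - y' t)^2
    <= ((x 0 - x' 0)^2 + (y 0 - y' 0)^2) * exp (4 * L * t).
Proof.
intros HL Hf Hg H H' t Ht.
assert (D := nonneg_derivative_le
  (fun t => - (((x t - x' t)^2 + (y t - y' t)^2) * exp (- (4 * L) * t)))
  (fun t => (4 * L * ((x t - x' t)^2 + (y t - y' t)^2)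
     - 2 * ((x t - x' t) * (f (x t) (y t) - f (x' t) (y' t)))
     - 2 * ((y t - y' t) * (g (x t) (y t) - g (x' t) (y' t)))) * exp (- (4 * L) * t)) 0 t Ht).
cbv beta in D. rewrite Rmult_0_r, exp_0 in D.
assert (E : exp (- (4 * L) * t) * exp (4 * L * t) = 1).
{ rewrite <- exp_plus, <- exp_0. f_equal; ring. }
assert (P := exp_pos (4 * L * t)).
set (N := (x t - x' t)^2 + (y t - y' t)^2) in *.
set (N0 := (x 0 - x' 0)^2 + (y 0 - y' 0)^2) in *.
replace N with (N * exp (- (4 * L) * t) * exp (4 * L * t)) by (rewrite Rmult_assoc, E; ring).
apply Rmult_le_compat_r; [lra|].
enough (- (N0 * 1) <= - (N * exp (- (4 * L) * t))) by lra.
apply D.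
- intros r Hr. destruct (H r) as [H1 H2]; [lra|]. destruct (H' r) as [H3 H4]; [lra|].
  auto_derive.
  { repeat split; trivial; eexists; eassumption. }
  replace (Derive (fun x0 : R => x x0) r) with (f (x r) (y r)) by (symmetry; apply is_derive_unique, H1).
  replace (Derive (fun x0 : R => y x0) r) with (g (x r) (y r)) by (symmetry; apply is_derive_unique, H2).
  replace (Derive (fun x0 : R => x' x0) r) with (f (x' r) (y' r)) by (symmetry; apply is_derive_unique, H3).
  replace (Derive (fun x0 : R => y' x0) r) with (g (x' r) (y' r)) by (symmetry; apply is_derive_unique, H4).
  ring.
- intros r Hr. apply Rmult_le_pos; [|left; apply exp_pos].
  assert (F := Hf (x r) (y r) (x' r) (y' r)). assert (G := Hg (x r) (y r) (x' r) (y' r)).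
  set (a := x r - x' r) in *. set (b := y r - y' r) in *.
  set (df := f (x r) (y r) - f (x' r) (y' r)) in *.
  set (dg := g (x r) (y r) - g (x' r) (y' r)) in *.
  assert (A1 : a * df <= Rabs a * Rabs df) by (rewrite <- Rabs_mult; apply Rle_abs).
  assert (A2 : b * dg <= Rabs b * Rabs dg) by (rewrite <- Rabs_mult; apply Rle_abs).
  assert (A3 := Rabs_pos a). assert (A4 := Rabs_pos b).
  assert (S1 : a ^ 2 = Rabs a ^ 2) by (symmetry; apply pow2_abs).
  assert (S2 : b ^ 2 = Rabs b ^ 2) by (symmetry; apply pow2_abs).
  rewrite S1, S2.
  assert (B1 : Rabs a * Rabs df <= Rabs a * (L * (Rabs a + Rabs b))) by (apply Rmult_le_compat_l; trivial).
  assert (B2 : Rabs b * Rabs dg <= Rabs b * (L * (Rabs a + Rabs b))) by (apply Rmult_le_compat_l; trivial).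
  assert (0 <= L * (Rabs a - Rabs b)^2) by (apply Rmult_le_pos; [lra | apply pow2_ge_0]).
  lra.
Qed.

(** * Limits at infinity *)

Lemma is_lim_p_infty_eps (f : R -> R) (l : R) :
  is_lim f p_infty l <->
  (forall e, 0 < e -> exists T, 0 <= T /\ forall t, T <= t -> Rabs (f t - l) < e).
Proof.
split.
- intros H e He. apply is_lim_spec in H. destruct (H (mkposreal e He)) as [T HT].
  exists (Rmax 0 (T + 1)). split; [apply Rmax_l|]. intros t Ht.
  apply (HT t). assert (H' := Rmax_r 0 (T + 1)). lra.
- intros H. apply is_lim_spec. intros e. destruct (H e (cond_pos e)) as [T [_ HT]].
  exists T. intros t Ht. apply HT; lra.
Qed.

(** If g' were at least e at a late time, the Lipschitz bound would keep it
    above e / 2 for a time e / (2 (K + 1)), on which g would move by a fixed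
    amount, although it converges. *)
Lemma barbalat (g g' : R -> R) K (l : R) :
  0 <= K -> (forall t, 0 <= t -> is_derive g t (g' t)) ->
  (forall s t, 0 <= s -> 0 <= t -> Rabs (g' s - g' t) <= K * Rabs (s - t)) ->
  is_lim g p_infty l -> is_lim g' p_infty 0.
Proof.
intros HK Hg HL Hl. apply is_lim_p_infty_eps. intros e He.
(* During a time [tau], [g'] changes by at most [e / 2]. *)
set (tau := e / (2 * (K + 1))).
assert (Htau : 0 < tau) by (apply Rdiv_lt_0_compat; lra).
assert (HKt : K * tau <= e / 2).
{ replace (e / 2) with ((K + 1) * tau) by (unfold tau; field; lra). nra. }
assert (He4 : 0 < e * tau / 4) by nra.
destruct (proj1 (is_lim_p_infty_eps g l) Hl _ He4) as [T [HT0 HT]].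
exists T. split; trivial. intros t Ht. rewrite Rminus_0_r.
destruct (mean_value g g' t (t + tau)) as [c [Hc E]]; [lra| |].
{ intros x Hx; apply Hg; lra. }
assert (H1 := HT t Ht). assert (H2 := HT (t + tau) ltac:(lra)).
assert (H3 : Rabs (g (t + tau) - g t) < e * tau / 2).
{ replace (g (t + tau) - g t) with ((g (t + tau) - l) - (g t - l)) by ring.
  apply Rabs_lt_between in H1, H2. apply Rabs_lt_between. lra. }
replace (t + tau - t) with tau in E by ring.
rewrite E, Rabs_mult, (Rabs_pos_eq tau) in H3 by lra.
assert (H4 : Rabs (g' c) < e / 2) by (apply (Rmult_lt_reg_r tau); lra).
assert (H5 : Rabs (g' t - g' c) <= e / 2).
{ eapply Rle_trans; [apply HL; lra|]. eapply Rle_trans; [|apply HKt].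
  apply Rmult_le_compat_l; trivial. apply Rabs_le; lra. }
replace (g' t) with ((g' t - g' c) + g' c) by ring.
eapply Rle_lt_trans; [apply Rabs_triang|]. lra.
Qed.

Lemma nondecreasing_bounded_limit (f : R -> R) T M :
  (forall s t, T <= s -> s <= t -> f s <= f t) -> (forall t, T <= t -> f t <= M) ->
  exists l : R, is_lim f p_infty l.
Proof.
intros Hf HM.
destruct (completeness (fun z => exists t, T <= t /\ z = f t)) as [l [Hub Hlub]].
- exists M. intros z [t [Ht ->]]. now apply HM.
- exists (f T), T. split; [lra|trivial].
- exists l. apply is_lim_p_infty_eps. intros e He.
  destruct (classic (exists t, T <= t /\ l - e < f t)) as [[t [Ht Hlt]]|Hno].
  + exists (Rmax 0 t). split; [apply Rmax_l|]. intros r Hr.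
    assert (t <= r) by (eapply Rle_trans; [apply Rmax_r|apply Hr]).
    assert (f t <= f r) by (apply Hf; lra).
    assert (f r <= l) by (apply Hub; exists r; split; trivial; lra).
    apply Rabs_lt_between; lra.
  + exfalso. assert (l <= l - e); [|lra]. apply Hlub. intros z [t [Ht ->]].
    destruct (Rle_dec (f t) (l - e)); trivial. exfalso. apply Hno. exists t; split; trivial; lra.
Qed.

Lemma nondecreasing_le_limit (f : R -> R) (l : R) :
  (forall s t, 0 <= s -> s <= t -> f s <= f t) -> is_lim f p_infty l ->
  forall t, 0 <= t -> f t <= l.
Proof.
intros Hf Hl t Ht. destruct (Rle_dec (f t) l) as [|Hn]; trivial. exfalso.
destruct (proj1 (is_lim_p_infty_eps f l) Hl (f t - l)) as [T [HT0 HT]]; [lra|].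
specialize (HT (Rmax T t) (Rmax_l _ _)). specialize (Hf t (Rmax T t) Ht (Rmax_r _ _)).
apply Rabs_lt_between in HT. lra.
Qed.

Lemma limit_at_only_zero (G x : R -> R) lo hi a :
  (forall z, continuous G z) ->
  (forall z, lo <= z <= hi -> G z = 0 -> z = a) ->
  (forall t, 0 <= t -> lo <= x t <= hi) ->
  is_lim (fun t => G (x t)) p_infty 0 -> is_lim x p_infty a.
Proof.
intros HG Ha Hx Hl. apply is_lim_p_infty_eps. intros e He.
assert (W : forall u v, lo <= u -> v <= hi -> (a < u \/ v < a) ->
   exists m, 0 < m /\ forall z, u <= z <= v -> m <= Rabs (G z)).
{ intros u v Hu Hv Huv. destruct (Rle_dec u v) as [Huv'|Huv'].
  - destruct (continuity_ab_min (fun z => Rabs (G z)) u v Huv') as [c [Hc Hc']].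
    { intros z _. apply continuity_pt_filterlim.
      apply (continuous_comp G Rabs); [apply HG | apply continuous_Rabs]. }
    exists (Rabs (G c)). split; trivial. apply Rabs_pos_lt. intros E.
    assert (c = a) by (apply Ha; trivial; lra). lra.
  - exists 1. split; [lra|]. intros; lra. }
destruct (W lo (Rmin hi (a - e))) as [m1 [Hm1 W1]].
{ lra. } { apply Rmin_l. } { right. assert (H := Rmin_r hi (a - e)). lra. }
destruct (W (Rmax lo (a + e)) hi) as [m2 [Hm2 W2]].
{ apply Rmax_l. } { lra. } { left. assert (H := Rmax_r lo (a + e)). lra. }
destruct (proj1 (is_lim_p_infty_eps _ _) Hl (Rmin m1 m2)) as [T [HT0 HT]].
{ now apply Rmin_glb_lt. }
exists T. split; trivial. intros t Ht. specialize (HT t Ht). rewrite Rminus_0_r in HT.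
assert (Hxt := Hx t ltac:(lra)).
assert (H1 := Rmin_l m1 m2). assert (H2 := Rmin_r m1 m2).
apply Rabs_lt_between. split.
- apply Rnot_le_lt. intros Hn. specialize (W1 (x t)).
  enough (m1 <= Rabs (G (x t))) by lra. apply W1. split; [lra|]. apply Rmin_glb; lra.
- apply Rnot_le_lt. intros Hn. specialize (W2 (x t)).
  enough (m2 <= Rabs (G (x t))) by lra. apply W2. split; [|lra]. apply Rmax_lub; lra.
Qed.

(** The strict form of monotonicity at a single point, from which extrema are
    excluded below. *)
Lemma negative_derivative_sign (f : R -> R) x l :
  is_derive f x l -> l < 0 ->
  exists d, 0 < d /\ forall z, Rabs (z - x) < d ->
    (x < z -> f z < f x) /\ (z < x -> f x < f z).
Proof.
intros H Hl. apply is_derive_Reals in H.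
assert (He : 0 < - l / 2) by lra.
destruct (H _ He) as [d Hd]. exists d. split; [apply cond_pos|].
intros z Hz.
assert (W : z <> x -> (f z - f x) / (z - x) < 0).
{ intros Hne. assert (Hne' : z - x <> 0) by lra. specialize (Hd (z - x) Hne' Hz).
  replace (x + (z - x)) with z in Hd by ring. apply Rabs_lt_between in Hd. lra. }
split; intros Hlt.
- assert (W' := W ltac:(lra)).
  assert (E : f z - f x = (f z - f x) / (z - x) * (z - x)) by (field; lra). nra.
- assert (W' := W ltac:(lra)).
  assert (E : f z - f x = (f z - f x) / (z - x) * (z - x)) by (field; lra). nra.
Qed.

(** * Trajectories of an oscillator *)

Definition lipschitz (K : R) (G : R -> R) :=
  forall a b, Rabs (G a - G b) <= K * Rabs (a - b).

Definition oscillator (beta : R) (G x y : R -> R) (t : R) : Prop :=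
  is_derive x t (y t) /\ is_derive y t (beta * y t + G (x t)).

Lemma lipschitz_continuous K G z : 0 <= K -> lipschitz K G -> continuous G z.
Proof.
intros HK HG. apply continuity_pt_filterlim. intros e He.
exists (e / (K + 1)). split. { apply Rdiv_lt_0_compat; lra. }
intros w [_ Hw]. simpl in *. unfold R_dist in *.
eapply Rle_lt_trans; [apply HG|].
replace e with ((K + 1) * (e / (K + 1))) by (field; lra).
assert (H := Rabs_pos (w - z)). nra.
Qed.

Lemma oscillator_lipschitz_pair beta G K :
  0 <= K -> lipschitz K G ->
  lipschitz_pair (1 + Rabs beta + K) (fun _ y => y) /\
  lipschitz_pair (1 + Rabs beta + K) (fun x y => beta * y + G x).
Proof.
intros HK HG. assert (Hb := Rabs_pos beta). split; intros a b a' b'.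
- assert (H1 := Rabs_pos (a - a')). assert (H2 := Rabs_pos (b - b')). nra.
- assert (H1 := Rabs_pos (a - a')). assert (H2 := Rabs_pos (b - b')).
  replace (beta * b + G a - (beta * b' + G a')) with (beta * (b - b') + (G a - G a')) by ring.
  eapply Rle_trans; [apply Rabs_triang|]. rewrite Rabs_mult. specialize (HG a a'). nra.
Qed.

Lemma oscillator_exists beta G K x0 y0 :
  0 <= K -> lipschitz K G ->
  exists x y : R -> R, x 0 = x0 /\ y 0 = y0 /\ forall t, oscillator beta G x y t.
Proof.
intros HK HG. destruct (oscillator_lipschitz_pair beta G K HK HG) as [H1 H2].
apply (global_solution (fun _ y => y) (fun x y => beta * y + G x) (1 + Rabs beta + K)); trivial.
assert (H := Rabs_pos beta); lra.
Qed.

Lemma oscillator_dependence beta G K x y x' y' :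
  0 <= K -> lipschitz K G ->
  (forall t, 0 <= t -> oscillator beta G x y t) ->
  (forall t, 0 <= t -> oscillator beta G x' y' t) ->
  forall t, 0 <= t ->
  (x t - x' t)^2 + (y t - y' t)^2 <=
  ((x 0 - x' 0)^2 + (y 0 - y' 0)^2) * exp (4 * (1 + Rabs beta + K) * t).
Proof.
intros HK HG H H'. destruct (oscillator_lipschitz_pair beta G K HK HG) as [H1 H2].
apply (gronwall (fun _ y => y) (fun x y => beta * y + G x) (1 + Rabs beta + K) x y x' y' ltac:(assert (Hb := Rabs_pos beta); lra) H1 H2 H H').
Qed.

Lemma oscillator_opp beta G x y t :
  oscillator beta G x y t ->
  oscillator beta (fun z => - G (- z)) (fun t => - x t) (fun t => - y t) t.
Proof.
intros [H1 H2]. split.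
- apply (is_derive_opp x t (y t) H1).
- replace (beta * - y t + - G (- - x t)) with (- (beta * y t + G (x t))).
  + apply (is_derive_opp y t _ H2).
  + rewrite Ropp_involutive; ring.
Qed.

(** Barbalat's lemma for the position: its derivative is Lipschitz because the
    acceleration is bounded. *)
Lemma velocity_vanishes beta G x y M Y (l : R) :
  (forall t, 0 <= t -> oscillator beta G x y t) ->
  (forall t, 0 <= t -> Rabs (G (x t)) <= M) ->
  (forall t, 0 <= t -> Rabs (y t) <= Y) ->
  is_lim x p_infty l -> is_lim y p_infty 0.
Proof.
intros H HM HY Hl.
assert (B : forall t, 0 <= t -> Rabs (beta * y t + G (x t)) <= Rabs beta * Y + M).
{ intros t Ht. eapply Rle_trans; [apply Rabs_triang|]. rewrite Rabs_mult.
  apply Rplus_le_compat; [|now apply HM].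
  apply Rmult_le_compat_l; [apply Rabs_pos | now apply HY]. }
apply (barbalat x y (Rabs beta * Y + M) l); trivial.
- eapply Rle_trans; [|apply (B 0 (Rle_refl 0))]. apply Rabs_pos.
- intros t Ht; now apply H.
- apply (bounded_derivative_lipschitz y (fun t => beta * y t + G (x t))); trivial.
  intros t Ht; now apply H.
Qed.

(** Barbalat's lemma for the velocity: the acceleration tends to 0, and so does
    the friction term. The acceleration is Lipschitz in time without
    differentiating the force, which is only Lipschitz after truncation. *)
Lemma force_vanishes beta G x y K M Y :
  0 <= K -> lipschitz K G ->
  (forall t, 0 <= t -> oscillator beta G x y t) ->
  (forall t, 0 <= t -> Rabs (G (x t)) <= M) ->
  (forall t, 0 <= t -> Rabs (y t) <= Y) ->
  is_lim y p_infty 0 -> is_lim (fun t => G (x t)) p_infty 0.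
Proof.
intros HK HG H HM HY Hl.
assert (HY0 : 0 <= Y) by (eapply Rle_trans; [|apply (HY 0 (Rle_refl 0))]; apply Rabs_pos).
assert (HM0 : 0 <= M) by (eapply Rle_trans; [|apply (HM 0 (Rle_refl 0))]; apply Rabs_pos).
assert (Hb := Rabs_pos beta).
assert (B : forall t, 0 <= t -> Rabs (beta * y t + G (x t)) <= Rabs beta * Y + M).
{ intros t Ht. eapply Rle_trans; [apply Rabs_triang|]. rewrite Rabs_mult.
  apply Rplus_le_compat; [|now apply HM].
  apply Rmult_le_compat_l; [apply Rabs_pos | now apply HY]. }
assert (Lx : forall s t, 0 <= s -> 0 <= t -> Rabs (x s - x t) <= Y * Rabs (s - t)).
{ apply (bounded_derivative_lipschitz x y); trivial. intros t Ht; now apply H. }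
assert (Ly : forall s t, 0 <= s -> 0 <= t ->
  Rabs (y s - y t) <= (Rabs beta * Y + M) * Rabs (s - t)).
{ apply (bounded_derivative_lipschitz y (fun t => beta * y t + G (x t))); trivial.
  intros t Ht; now apply H. }
assert (C : is_lim (fun t => beta * y t + G (x t)) p_infty 0).
{ apply (barbalat y _ (Rabs beta * (Rabs beta * Y + M) + K * Y) 0); trivial.
  - assert (0 <= Rabs beta * Y) by now apply Rmult_le_pos.
    apply Rplus_le_le_0_compat; apply Rmult_le_pos; lra.
  - intros t Ht; now apply H.
  - intros s t Hs Ht.
    replace (beta * y s + G (x s) - (beta * y t + G (x t))) with
      (beta * (y s - y t) + (G (x s) - G (x t))) by ring.
    eapply Rle_trans; [apply Rabs_triang|]. rewrite Rabs_mult, Rmult_plus_distr_r.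
    apply Rplus_le_compat.
    + rewrite Rmult_assoc. apply Rmult_le_compat_l; trivial. now apply Ly.
    + eapply Rle_trans; [apply HG|]. rewrite Rmult_assoc.
      apply Rmult_le_compat_l; trivial. now apply Lx. }
apply (is_lim_ext (fun t => (beta * y t + G (x t)) - beta * y t)).
{ intros t; ring. }
replace (Finite 0) with (Finite (0 - beta * 0)) by (f_equal; ring).
apply (is_lim_minus' _ _ _ _ _ C). now apply (is_lim_scal_l y beta p_infty 0).
Qed.

(** Beyond the velocity M / beta the amplification beats the force. In terms
    of exp (- beta t) (y - M / beta), which is nondecreasing, the velocity
    never falls again. *)
Lemma escape_velocity beta G x y M t1 :
  0 < beta -> (forall z, Rabs (G z) <= M) ->
  (forall t, 0 <= t -> oscillator beta G x y t) -> 0 <= t1 -> M / beta < y t1 ->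
  forall t, t1 <= t -> x t1 + y t1 * (t - t1) <= x t.
Proof.
intros Hb HM H Ht1 Hy.
assert (HM0 : 0 <= M) by (eapply Rle_trans; [|apply (HM 0)]; apply Rabs_pos).
assert (Q : 0 <= M / beta) by (apply Rdiv_le_0_compat; lra).
assert (V : forall t, t1 <= t -> y t1 <= y t).
{ intros t Ht.
  assert (D := nonneg_derivative_le (fun t => exp (- beta * t) * (y t - M / beta))
    (fun t => exp (- beta * t) * (G (x t) + M)) t1 t Ht). cbv beta in D.
  assert (D' : exp (- beta * t1) * (y t1 - M / beta) <= exp (- beta * t) * (y t - M / beta)).
  { apply D.
    - intros r Hr. destruct (H r ltac:(lra)) as [_ Hy'].
      auto_derive. { repeat split; now exists (beta * y r + G (x r)). }
      replace (Derive (fun x0 : R => y x0) r) with (beta * y r + G (x r))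
        by (symmetry; apply is_derive_unique, Hy').
      field. lra.
    - intros r _. apply Rmult_le_pos; [left; apply exp_pos|].
      specialize (HM (x r)). apply Rabs_le_between in HM. lra. }
  clear D. assert (E : exp (- beta * t) <= exp (- beta * t1)).
  { destruct (Rle_lt_or_eq_dec t1 t Ht) as [E|E].
    - left; apply exp_increasing; nra.
    - rewrite E; lra. }
  assert (P := exp_pos (- beta * t)).
  assert (exp (- beta * t) * (y t1 - M / beta) <= exp (- beta * t1) * (y t1 - M / beta))
    by (apply Rmult_le_compat_r; lra).
  assert (y t1 - M / beta <= y t - M / beta); [|lra].
  apply (Rmult_le_reg_l (exp (- beta * t))); lra. }
intros t Ht. destruct (mean_value x y t1 t Ht) as [c [Hc E]].
{ intros r Hr; apply H; lra. }
assert (W := V c ltac:(lra)). nra.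
Qed.

(** Maximum principle: at an interior minimum below b the velocity is 0 and the
    acceleration is G < 0. *)
Lemma no_dip beta G x y b t0 t1 t2 :
  (forall z, z < b -> G z < 0) ->
  (forall t, 0 <= t -> oscillator beta G x y t) ->
  0 <= t0 -> t0 < t1 -> t1 < t2 -> x t1 < x t0 -> x t1 < x t2 -> x t1 < b -> False.
Proof.
intros HG H H0 H1 H2 H3 H4 H5.
destruct (continuity_ab_min x t0 t2) as [m [Hm Hm']]; [lra| |].
{ intros c Hc. apply continuity_pt_filterlim, (is_derive_continuous x c (y c)), H; lra. }
assert (Hxm := Hm t1 ltac:(lra)).
assert (m <> t0) by (intros ->; lra). assert (m <> t2) by (intros ->; lra).
destruct (H m ltac:(lra)) as [Dx Dy].
set (r := Rmin (m - t0) (t2 - m)). assert (Hr : 0 < r) by (apply Rmin_glb_lt; lra).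
assert (r1 := Rmin_l (m - t0) (t2 - m)). assert (r2 := Rmin_r (m - t0) (t2 - m)). fold r in r1, r2.
destruct (Rtotal_order (y m) 0) as [Hy|[Hy|Hy]].
- destruct (negative_derivative_sign x m (y m) Dx Hy) as [d [Hd W]].
  assert (Hq : 0 < Rmin d r) by now apply Rmin_glb_lt.
  assert (q1 := Rmin_l d r). assert (q2 := Rmin_r d r).
  destruct (W (m + Rmin d r / 2)) as [W1 _].
  { replace (m + Rmin d r / 2 - m) with (Rmin d r / 2) by ring. rewrite Rabs_pos_eq; lra. }
  specialize (W1 ltac:(lra)). specialize (Hm (m + Rmin d r / 2) ltac:(lra)). lra.
- rewrite Hy, Rmult_0_r, Rplus_0_l in Dy.
  destruct (negative_derivative_sign y m (G (x m)) Dy) as [d [Hd W]]. { apply HG; lra. }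
  assert (Hq : 0 < Rmin d r) by now apply Rmin_glb_lt.
  assert (q1 := Rmin_l d r). assert (q2 := Rmin_r d r).
  destruct (MVT_cor2 x y m (m + Rmin d r / 2)) as [c [E Hc]]; [lra| |].
  { intros c Hc. apply is_derive_Reals, H; lra. }
  destruct (W c) as [W1 _]. { rewrite Rabs_pos_eq; lra. }
  specialize (W1 ltac:(lra)). specialize (Hm (m + Rmin d r / 2) ltac:(lra)). nra.
- destruct (negative_derivative_sign (fun t => - x t) m (- y m)) as [d [Hd W]].
  { apply (is_derive_opp x m (y m) Dx). } { lra. }
  assert (Hq : 0 < Rmin d r) by now apply Rmin_glb_lt.
  assert (q1 := Rmin_l d r). assert (q2 := Rmin_r d r).
  destruct (W (m - Rmin d r / 2)) as [_ W1].
  { replace (m - Rmin d r / 2 - m) with (- (Rmin d r / 2)) by ring. rewrite Rabs_Ropp, Rabs_pos_eq; lra. }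
  specialize (W1 ltac:(lra)). specialize (Hm (m - Rmin d r / 2) ltac:(lra)). lra.
Qed.

Lemma no_bump beta G x y b t0 t1 t2 :
  (forall z, b < z -> 0 < G z) ->
  (forall t, 0 <= t -> oscillator beta G x y t) ->
  0 <= t0 -> t0 < t1 -> t1 < t2 -> x t0 < x t1 -> x t2 < x t1 -> b < x t1 -> False.
Proof.
intros HG H H0 H1 H2 H3 H4 H5.
apply (no_dip beta (fun z => - G (- z)) (fun t => - x t) (fun t => - y t) (- b) t0 t1 t2); try lra.
- intros z Hz. assert (W := HG (- z) ltac:(lra)). lra.
- intros t Ht. now apply oscillator_opp, H.
Qed.

(** * Shooting towards the saddle *)

Section Shooting.
Variables (beta K M theta b : R) (G : R -> R).
Hypothesis beta_pos : 0 < beta.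
Hypothesis K_nonneg : 0 <= K.
Hypothesis G_lip : lipschitz K G.
Hypothesis G_bounded : forall z, Rabs (G z) <= M.
Hypothesis theta_lt_b : theta < b.
Hypothesis G_neg : forall z, z < b -> G z < 0.
Hypothesis G_pos : forall z, b < z -> 0 < G z.

Lemma velocity_dependence x y x' y' t :
  (forall t, 0 <= t -> oscillator beta G x y t) ->
  (forall t, 0 <= t -> oscillator beta G x' y' t) -> x 0 = x' 0 -> 0 <= t ->
  Rabs (x t - x' t) <= Rabs (y 0 - y' 0) * exp (2 * (1 + Rabs beta + K) * t).
Proof.
intros H H' H0 Ht.
assert (W := oscillator_dependence beta G K x y x' y' K_nonneg G_lip H H' t Ht).
rewrite H0, Rminus_diag, pow_i, Rplus_0_l in W by lia.
replace (4 * (1 + Rabs beta + K) * t) with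
  (2 * (1 + Rabs beta + K) * t + 2 * (1 + Rabs beta + K) * t) in W by ring.
rewrite exp_plus in W. set (e := exp (2 * (1 + Rabs beta + K) * t)) in *.
assert (He : 0 < e) by apply exp_pos.
assert (Ha := Rabs_pos (y 0 - y' 0)).
rewrite <- (Rabs_pos_eq (Rabs (y 0 - y' 0) * e)) by (apply Rmult_le_pos; lra).
apply Rsqr_le_abs_0. unfold Rsqr.
assert (S := pow2_abs (y 0 - y' 0)). assert (S' := pow2_ge_0 (y t - y' t)). nra.
Qed.

(** The velocity is the supremum v of those for which the trajectory falls below
    theta at some time. Both this event and that of exceeding b are open in
    the velocity, and no trajectory does both, by no_dip and no_bump. So
    neither can occur at v: falling would also occur slightly above v, and
    exceeding would also occur for falling trajectories slightly below v. *)
Lemma trapped_trajectory :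
  exists x y : R -> R, x 0 = theta /\ (forall t, oscillator beta G x y t) /\
    forall t, 0 <= t -> theta <= x t <= b.
Proof.
assert (HM0 : 0 <= M) by (eapply Rle_trans; [|apply (G_bounded 0)]; apply Rabs_pos).
pose (falls := fun v => exists x y t, (forall t, oscillator beta G x y t) /\
  x 0 = theta /\ y 0 = v /\ 0 <= t /\ x t < theta).
destruct (completeness falls) as [v [Hub Hlub]].
- exists (M / beta). intros v (x & y & t & H & H0 & H1 & Ht & Hlt).
  destruct (Rle_dec v (M / beta)) as [|Hn]; trivial. exfalso.
  assert (E := escape_velocity beta G x y M 0 beta_pos G_bounded (fun t _ => H t)
    (Rle_refl 0) ltac:(lra) t Ht).
  assert (Q : 0 <= M / beta) by (apply Rdiv_le_0_compat; lra). nra.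
- (* A trajectory that starts downwards falls below [theta] at once. *)
  exists (-1). destruct (oscillator_exists beta G K theta (-1) K_nonneg G_lip) as (x & y & H0 & H1 & H).
  destruct (H 0) as [Dx _]. rewrite H1 in Dx.
  destruct (negative_derivative_sign x 0 (-1) Dx ltac:(lra)) as [d [Hd W]].
  destruct (W (d / 2)) as [W1 _]. { rewrite Rabs_pos_eq; lra. }
  exists x, y, (d / 2). rewrite <- H0. repeat split; trivial; try lra; apply H.
- destruct (oscillator_exists beta G K theta v K_nonneg G_lip) as (x & y & H0 & H1 & H).
  exists x, y. split; trivial. split; trivial. intros t Ht.
  set (e := exp (2 * (1 + Rabs beta + K) * t)). assert (He : 0 < e) by apply exp_pos.
  split; apply Rnot_lt_le; intros Hlt.
  + (* Raising the velocity by [dv] moves the position at time [t] by at most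
       half of the gap to [theta]. *)
    set (dv := (theta - x t) / (2 * e)).
    assert (Hdv : 0 < dv) by (apply Rdiv_lt_0_compat; lra).
    destruct (oscillator_exists beta G K theta (v + dv) K_nonneg G_lip) as (x' & y' & H0' & H1' & H').
    assert (W := velocity_dependence x' y' x y t (fun t _ => H' t) (fun t _ => H t) ltac:(lra) Ht).
    fold e in W. rewrite H1, H1', (Rabs_pos_eq (v + dv - v)) in W by lra.
    replace ((v + dv - v) * e) with ((theta - x t) / 2) in W by (unfold dv; field; lra).
    apply Rabs_le_between in W.
    assert (v + dv <= v); [|lra]. apply Hub. exists x', y', t. repeat split; trivial; try lra; apply H'.
  + set (dv := (x t - b) / (2 * e)).
    assert (Hdv : 0 < dv) by (apply Rdiv_lt_0_compat; lra).
    destruct (classic (exists w, falls w /\ v - dv < w)) as [[w [Hw Hvw]]|Hno].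
    * assert (Hwv := Hub w Hw). destruct Hw as (x' & y' & t' & H' & H0' & H1' & Ht' & Hlt').
      assert (W := velocity_dependence x' y' x y t (fun t _ => H' t) (fun t _ => H t) ltac:(lra) Ht).
      fold e in W. rewrite H1, H1' in W.
      assert (Habs : Rabs (w - v) <= dv) by (apply Rabs_le; lra).
      assert (Rabs (w - v) * e <= (x t - b) / 2).
      { replace ((x t - b) / 2) with (dv * e) by (unfold dv; field; lra).
        apply Rmult_le_compat_r; lra. }
      assert (Hx' : b < x' t) by (apply Rabs_le_between in W; lra).
      assert (t' <> 0) by (intros ->; lra). assert (t <> 0) by (intros ->; lra).
      destruct (Rtotal_order t t') as [Hc|[Hc|Hc]].
      -- apply (no_bump beta G x' y' b 0 t t'); trivial; try lra.
      -- subst t'; lra.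
      -- apply (no_dip beta G x' y' b 0 t' t); trivial; try lra.
    * assert (v <= v - dv); [|lra]. apply Hlub. intros w Hw.
      destruct (Rle_dec w (v - dv)); trivial. exfalso. apply Hno. exists w. split; trivial; lra.
Qed.

(** After a first descent the trajectory can never rise again, by no_dip; so it
    is eventually monotone and converges, and its limit is a zero of the
    force. *)
Lemma saddle_trajectory :
  exists x y : R -> R, x 0 = theta /\ (forall t, oscillator beta G x y t) /\
    (forall t, 0 <= t -> theta <= x t <= b) /\ is_lim x p_infty b /\ is_lim y p_infty 0.
Proof.
destruct trapped_trajectory as (x & y & H0 & H & Hx).
exists x, y. split; trivial. split; trivial. split; trivial.
assert (HM0 : 0 <= M) by (eapply Rle_trans; [|apply (G_bounded 0)]; apply Rabs_pos).
assert (Q : 0 <= M / beta) by (apply Rdiv_le_0_compat; lra).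
assert (U : forall x y : R -> R, forall G : R -> R, (forall z, Rabs (G z) <= M) ->
  (forall t, oscillator beta G x y t) -> forall c,
  (forall t, 0 <= t -> x t <= c) -> forall t, 0 <= t -> y t <= M / beta).
{ intros x' y' G' HG' H' c Hc t Ht. apply Rnot_lt_le. intros Hlt.
  assert (Hyt : 0 < y' t) by lra.
  assert (Hxt := Hc t Ht).
  assert (Hs : 0 <= (c - x' t + 1) / y' t) by (apply Rdiv_le_0_compat; lra).
  assert (E := escape_velocity beta G' x' y' M t beta_pos HG' (fun t _ => H' t) Ht Hlt
    (t + (c - x' t + 1) / y' t) ltac:(lra)).
  assert (Hc' := Hc (t + (c - x' t + 1) / y' t) ltac:(lra)).
  replace (y' t * (t + (c - x' t + 1) / y' t - t)) with (c - x' t + 1) in E by (field; lra). lra. }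
assert (Hy : forall t, 0 <= t -> Rabs (y t) <= M / beta).
{ intros t Ht. apply Rabs_le. split.
  - assert (W := U (fun t => - x t) (fun t => - y t) (fun z => - G (- z))). cbv beta in W.
    enough (- y t <= M / beta) by lra. apply (W ltac:(intros z; rewrite Rabs_Ropp; apply G_bounded)
      ltac:(intros; apply oscillator_opp, H) (- theta)); trivial.
    intros r Hr. specialize (Hx r Hr). lra.
  - apply (U x y G G_bounded H b); trivial. intros r Hr. now apply Hx. }
assert (L : exists l : R, is_lim x p_infty l).
{ destruct (classic (exists s t, 0 <= s < t /\ x t < x s)) as [(s & t & Hst & Hlt)|Hno].
  - destruct (nondecreasing_bounded_limit (fun t => - x t) t (- theta)) as [l Hl].
    + intros p q Hp Hpq. apply Rnot_lt_le. intros Hn.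
      assert (p <> q) by (intros ->; lra).
      assert (Hbx := Hx s ltac:(lra)).
      destruct (Rle_dec (x p) (x t)) as [Hc|Hc].
      * apply (no_dip beta G x y b s p q); try lra; trivial.
      * assert (t <> p) by (intros ->; lra).
        apply (no_dip beta G x y b s t p); try lra; trivial.
    + intros r Hr. assert (W := Hx r ltac:(lra)). lra.
    + exists (- l). apply (is_lim_ext (fun t => - - x t)). { intros; ring. }
      apply (is_lim_opp (fun t => - x t) p_infty l Hl).
  - apply (nondecreasing_bounded_limit x 0 b).
    + intros s t Hs Hst. apply Rnot_lt_le. intros Hn. apply Hno. exists s, t.
      assert (s <> t) by (intros ->; lra). lra.
    + intros t Ht; now apply Hx. }
destruct L as [l Hl].
assert (Ly : is_lim y p_infty 0).
{ apply (velocity_vanishes beta G x y M (M / beta) l); trivial. }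
split; trivial.
apply (limit_at_only_zero G x theta b b); trivial.
- intros z; now apply (lipschitz_continuous K).
- intros z [_ Hz] E. destruct (Rle_lt_or_eq_dec z b Hz) as [Hz'|]; trivial.
  specialize (G_neg z Hz'). lra.
- apply (force_vanishes beta G x y K M (M / beta)); trivial.
Qed.
End Shooting.

Lemma oscillator_unique beta G K x y x' y' :
  0 <= K -> lipschitz K G ->
  (forall t, 0 <= t -> oscillator beta G x y t) ->
  (forall t, 0 <= t -> oscillator beta G x' y' t) -> x 0 = x' 0 -> y 0 = y' 0 ->
  forall t, 0 <= t -> x t = x' t /\ y t = y' t.
Proof.
intros HK HG H H' Hx Hy t Ht.
assert (W := oscillator_dependence beta G K x y x' y' HK HG H H' t Ht).
rewrite Hx, Hy, !Rminus_diag, pow_i, Rplus_0_l, Rmult_0_l in W by lia.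
assert (A := pow2_ge_0 (x t - x' t)). assert (B := pow2_ge_0 (y t - y' t)).
split; apply Rminus_diag_uniq, Rsqr_eq_0; unfold Rsqr; nra.
Qed.

Lemma oscillator_reverse beta G x y t :
  oscillator beta G x y (- t) ->
  oscillator (- beta) G (fun t => x (- t)) (fun t => - y (- t)) t.
Proof.
intros [H1 H2]. split.
- auto_derive. { now exists (y (- t)). }
  replace (Derive (fun x0 : R => x x0) (- t)) with (y (- t)) by (symmetry; apply is_derive_unique, H1).
  ring.
- auto_derive. { now exists (beta * y (- t) + G (x (- t))). }
  replace (Derive (fun x0 : R => y x0) (- t)) with (beta * y (- t) + G (x (- t)))
    by (symmetry; apply is_derive_unique, H2).
  ring.
Qed.

Lemma crossing (x : R -> R) c t :
  (forall r, continuous x r) -> 0 <= t -> x 0 < c <= x t \/ x t <= c < x 0 ->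
  exists r, 0 <= r <= t /\ x r = c.
Proof.
intros Hx Ht Hc.
destruct (IVT_gen x 0 t c) as [r [Hr E]].
- intros r. apply continuity_pt_filterlim, Hx.
- destruct Hc; [rewrite Rmin_left, Rmax_right by lra | rewrite Rmin_right, Rmax_left by lra]; lra.
- rewrite Rmin_left, Rmax_right in Hr by lra. now exists r.
Qed.

Lemma energy_decay alpha G V P p y :
  (forall z, is_derive V z (- G z)) -> oscillator (- alpha) G P p y ->
  is_derive (fun y => (p y)^2 / 2 + V (P y)) y (- alpha * (p y)^2).
Proof.
intros HV [H1 H2]. auto_derive.
{ repeat split. now exists (- alpha * p y + G (P y)). now exists (- G (P y)). now exists (p y). }
replace (Derive (fun x : R => V x) (P y)) with (- G (P y)) by (symmetry; apply is_derive_unique, HV).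
replace (Derive (fun x : R => P x) y) with (p y) by (symmetry; apply is_derive_unique, H1).
replace (Derive (fun x : R => p x) y) with (- alpha * p y + G (P y))
  by (symmetry; apply is_derive_unique, H2).
field.
Qed.

(** * From the saddle to the well *)

Section Heteroclinic.
Variables (alpha K M lo a b : R) (G V : R -> R).
Hypothesis alpha_pos : 0 < alpha.
Hypothesis K_nonneg : 0 <= K.
Hypothesis G_lip : lipschitz K G.
Hypothesis G_bounded : forall z, Rabs (G z) <= M.
Hypothesis lo_lt_a : lo < a.
Hypothesis a_lt_b : a < b.
Hypothesis G_left : forall z, lo <= z -> z < a -> 0 < G z.
Hypothesis G_mid : forall z, a < z -> z < b -> G z < 0.
Hypothesis G_right : forall z, b < z -> 0 < G z.
Hypothesis V_derive : forall z, is_derive V z (- G z).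
Hypothesis V_barrier : V b <= V lo.

(** In reversed time the friction changes sign and the trajectory leaving the
    saddle becomes one that tends to it. For the shooting, the force is frozen
    below the starting point theta, which makes it negative on the whole
    half-line below b; the trapped trajectory never sees the difference. *)
Lemma unstable_manifold :
  exists P p : R -> R, P 0 = (a + b) / 2 /\ (forall y, oscillator (- alpha) G P p y) /\
    (forall t, 0 <= t -> (a + b) / 2 <= P (- t) <= b) /\
    is_lim (fun t => P (- t)) p_infty b /\ is_lim (fun t => p (- t)) p_infty 0.
Proof.
set (theta := (a + b) / 2).
assert (Hclamp : lipschitz K (fun z => G (Rmax theta z))).
{ intros u v. eapply Rle_trans; [apply G_lip|]. apply Rmult_le_compat_l; trivial.
  unfold Rmax; destruct (Rle_dec theta u), (Rle_dec theta v);
    unfold Rabs; repeat destruct Rcase_abs; lra. }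
destruct (saddle_trajectory alpha K M theta b (fun z => G (Rmax theta z))) as
  (x & y & H0 & H & Hx & Lx & Ly); trivial.
{ unfold theta; lra. }
{ intros z Hz. apply G_mid.
  - eapply Rlt_le_trans; [|apply Rmax_l]. unfold theta; lra.
  - apply Rmax_lub_lt; trivial. unfold theta; lra. }
{ intros z Hz. apply G_right. eapply Rlt_le_trans; [apply Hz | apply Rmax_r]. }
destruct (oscillator_exists (- alpha) G K theta (- y 0) K_nonneg G_lip) as (P & p & HP0 & Hp0 & HP).
assert (E : forall t, 0 <= t -> P (- t) = x t /\ - p (- t) = y t).
{ apply (oscillator_unique alpha G K (fun t => P (- t)) (fun t => - p (- t))); trivial.
  - intros t Ht. rewrite <- (Ropp_involutive alpha). apply oscillator_reverse, HP.
  - intros t Ht. destruct (H t) as [H1 H2]. split; trivial.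
    rewrite Rmax_right in H2; trivial. now apply Hx.
  - now rewrite Ropp_0, HP0.
  - rewrite Ropp_0, Hp0; ring. }
assert (N : Rbar_locally' p_infty (fun t => 0 <= t)).
{ exists 0. intros t Ht; lra. }
exists P, p. repeat split; trivial; try apply HP.
- destruct (E t) as [-> _]; trivial. now apply Hx.
- destruct (E t) as [-> _]; trivial. now apply Hx.
- apply (is_lim_ext_loc x); trivial.
  apply (filter_imp _ _ (fun t Ht => eq_sym (proj1 (E t Ht)))), N.
- apply (is_lim_ext_loc (fun t => - y t)).
  + apply (filter_imp (fun t => 0 <= t)); trivial. intros t Ht. destruct (E t Ht); lra.
  + replace (Finite 0) with (Finite (- 0)) by (f_equal; ring).
    apply (is_lim_opp y p_infty 0 Ly).
Qed.

(** The energy tends to V b in the past and never increases. Equality at time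
    0 would mean that no energy was ever lost, hence that P rested at
    (a + b) / 2 in the whole past, instead of coming from b. *)
Lemma energy_below_saddle P p :
  P 0 = (a + b) / 2 -> (forall y, oscillator (- alpha) G P p y) ->
  is_lim (fun t => P (- t)) p_infty b -> is_lim (fun t => p (- t)) p_infty 0 ->
  (p 0)^2 / 2 + V (P 0) < V b.
Proof.
intros H0 H LP Lp.
set (E := fun y => (p y)^2 / 2 + V (P y)).
assert (DE : forall y, is_derive E y (- alpha * (p y)^2)).
{ intros y; now apply (energy_decay alpha G V). }
assert (mono : forall y z, y <= z -> E z <= E y).
{ intros y z Hyz. enough (- E y <= - E z) by lra.
  apply (nonneg_derivative_le (fun y => - E y) (fun y => alpha * (p y)^2) y z Hyz).
  - intros r _. replace (alpha * (p r)^2) with (- (- alpha * (p r)^2)) by ring.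
    apply (is_derive_opp E r _ (DE r)).
  - intros r _. apply Rmult_le_pos; [lra | apply pow2_ge_0]. }
assert (LE : is_lim (fun t => E (- t)) p_infty (V b)).
{ replace (Finite (V b)) with (Finite (0 * 0 * / 2 + V b)) by (f_equal; ring).
  apply (is_lim_ext (fun t => p (- t) * p (- t) * / 2 + V (P (- t)))).
  { intros t. unfold E. field. }
  apply (is_lim_plus' (fun t => p (- t) * p (- t) * / 2)).
  - apply (is_lim_scal_r (fun t => p (- t) * p (- t)) (/ 2) p_infty (0 * 0)).
    now apply (is_lim_mult (fun t => p (- t)) (fun t => p (- t)) p_infty 0 0).
  - apply (is_lim_comp_continuous (fun t => P (- t)) V); trivial.
    apply (is_derive_continuous V b _ (V_derive b)). }
assert (top : forall y, y <= 0 -> E y <= V b).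
{ intros y Hy. replace y with (- - y) by ring.
  apply (nondecreasing_le_limit (fun t => E (- t))); trivial; [|lra].
  intros s t Hs Hst. apply mono; lra. }
apply Rnot_le_lt. intros Hge. fold (E 0) in Hge.
(* The energy would be constant in the past, and its rate of change is [- alpha p^2]. *)
assert (still : forall y, y <= 0 -> p y = 0).
{ intros y Hy. destruct (Req_dec (p y) 0) as [|Hne]; trivial. exfalso.
  assert (Hsq : 0 < (p y)^2) by now apply pow2_gt_0.
  destruct (negative_derivative_sign E y _ (DE y)) as [d [Hd W]]; [nra|].
  destruct (W (y - d / 2)) as [_ W1].
  { replace (y - d / 2 - y) with (- (d / 2)) by ring. rewrite Rabs_Ropp, Rabs_pos_eq; lra. }
  specialize (W1 ltac:(lra)). assert (T := top (y - d / 2) ltac:(lra)).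
  assert (Q := mono y 0 Hy). lra. }
assert (const : forall t, 0 <= t -> P (- t) = (a + b) / 2).
{ intros t Ht. destruct (mean_value P p (- t) 0) as [c [Hc Ec]]; [lra| |].
  { intros r _; apply H. }
  rewrite (still c) in Ec by lra. lra. }
destruct (proj1 (is_lim_p_infty_eps _ _) LP ((b - a) / 4)) as [T [HT0 HT]]; [lra|].
specialize (HT T (Rle_refl T)). rewrite const in HT by trivial.
apply Rabs_lt_between in HT. lra.
Qed.

(** The energy stays below V b <= V lo, so by continuity P meets neither b nor
    lo. The loss of energy is the integral of alpha p^2, which is finite. *)
Lemma forward_limit P p :
  P 0 = (a + b) / 2 -> (forall y, oscillator (- alpha) G P p y) ->
  (p 0)^2 / 2 + V (P 0) < V b ->
  (forall y, 0 <= y -> lo < P y < b) /\ is_lim P p_infty a.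
Proof.
intros H0 H HE.
set (E := fun y => (p y)^2 / 2 + V (P y)). fold (E 0) in HE.
assert (DE : forall y, is_derive (fun y => - E y) y (alpha * (p y)^2)).
{ intros y. replace (alpha * (p y)^2) with (- (- alpha * (p y)^2)) by ring.
  apply (is_derive_opp E). now apply (energy_decay alpha G V). }
assert (mono : forall y z, y <= z -> - E y <= - E z).
{ intros y z Hyz.
  apply (nonneg_derivative_le (fun y => - E y) (fun y => alpha * (p y)^2) y z Hyz).
  - intros r _; apply DE.
  - intros r _. apply Rmult_le_pos; [lra | apply pow2_ge_0]. }
assert (VE : forall y, V (P y) <= E y).
{ intros y. unfold E. assert (W := pow2_ge_0 (p y)). lra. }
assert (cP : forall y, continuous P y).
{ intros y. apply (is_derive_continuous P y (p y)), H. }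
assert (cV : forall z, continuous V z).
{ intros z. apply (is_derive_continuous V z _ (V_derive z)). }
assert (avoid : forall y c, 0 <= y -> V b <= V c -> P y <> c).
{ intros y c Hy Hc Hyc. assert (W := VE y). assert (W' := mono 0 y Hy). rewrite Hyc in W. lra. }
assert (range : forall y, 0 <= y -> lo < P y < b).
{ intros y Hy. split; apply Rnot_le_lt; intros Hn.
  - destruct (crossing P lo y cP Hy) as [r [Hr Er]]; [lra|].
    apply (avoid r lo); trivial; lra.
  - destruct (crossing P b y cP Hy) as [r [Hr Er]]; [lra|].
    apply (avoid r b); trivial; lra. }
split; trivial.
(* Near [b] the potential already exceeds the initial energy; this keeps the
   zero [b] of the force away from the closure of the orbit. *)
assert (gap : exists c, c < b /\ forall y, 0 <= y -> P y <= c).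
{ assert (Hc := cV b). apply continuity_pt_filterlim in Hc.
  destruct (Hc (V b - E 0)) as [d [Hd Hd']]; [lra|].
  exists (b - d). split; [lra|]. intros y Hy. apply Rnot_lt_le. intros Hn.
  assert (R := range y Hy). assert (W := VE y). assert (W' := mono 0 y Hy).
  assert (Q : Rabs (V (P y) - V b) < V b - E 0).
  { apply Hd'. split. { split; [exact I | lra]. } simpl. unfold R_dist.
    apply Rabs_lt_between. lra. }
  apply Rabs_lt_between in Q. lra. }
destruct gap as [c [Hcb Hc]].
destruct (continuity_ab_min V lo b) as [m [Hm _]]; [lra| |].
{ intros z _. apply continuity_pt_filterlim, cV. }
destruct (nondecreasing_bounded_limit (fun y => - E y) 0 (- V m)) as [l Hl].
{ intros s t _ Hst; now apply mono. }
{ intros t Ht. assert (R := range t Ht). assert (W := VE t). assert (W' := Hm (P t) ltac:(lra)). lra. }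
(* The kinetic energy is at most [E 0 - V m], and [|p| <= p^2 + 1]. *)
set (Y := 2 * (E 0 - V m) + 1).
assert (Hp : forall y, 0 <= y -> Rabs (p y) <= Y).
{ intros y Hy. assert (R := range y Hy). assert (W' := Hm (P y) ltac:(lra)).
  assert (W := mono 0 y Hy). unfold E at 2 in W.
  assert (S := pow2_abs (p y)). assert (A := Rabs_pos (p y)).
  assert (Q := pow2_ge_0 (Rabs (p y) - 1)). unfold Y. nra. }
assert (HY : 0 <= Y) by (eapply Rle_trans; [|apply (Hp 0 (Rle_refl 0))]; apply Rabs_pos).
assert (HM0 : 0 <= M) by (eapply Rle_trans; [|apply (G_bounded 0)]; apply Rabs_pos).
assert (Lp : forall s t, 0 <= s -> 0 <= t -> Rabs (p s - p t) <= (alpha * Y + M) * Rabs (s - t)).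
{ apply (bounded_derivative_lipschitz p (fun t => - alpha * p t + G (P t))).
  - intros t _; apply H.
  - intros t Ht. eapply Rle_trans; [apply Rabs_triang|].
    rewrite Rabs_mult, Rabs_Ropp, (Rabs_pos_eq alpha) by lra.
    specialize (Hp t Ht). specialize (G_bounded (P t)). nra. }
assert (Lsq : is_lim (fun y => alpha * (p y)^2) p_infty 0).
{ apply (barbalat (fun y => - E y) _ (alpha * (2 * Y) * (alpha * Y + M)) l); trivial.
  - apply Rmult_le_pos. { apply Rmult_le_pos; lra. } apply Rplus_le_le_0_compat; trivial. nra.
  - intros s t Hs Ht.
    replace (alpha * (p s)^2 - alpha * (p t)^2) with (alpha * (p s + p t) * (p s - p t)) by ring.
    rewrite Rabs_mult, (Rmult_assoc (alpha * (2 * Y))). apply Rmult_le_compat; try apply Rabs_pos.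
    + rewrite Rabs_mult, (Rabs_pos_eq alpha) by lra. apply Rmult_le_compat_l; [lra|].
      eapply Rle_trans; [apply Rabs_triang|]. assert (A := Hp s Hs). assert (B := Hp t Ht). lra.
    + now apply Lp. }
assert (Lp0 : is_lim p p_infty 0).
{ apply is_lim_p_infty_eps. intros e He.
  destruct (proj1 (is_lim_p_infty_eps _ _) Lsq (alpha * e^2)) as [T [HT0 HT]].
  { apply Rmult_lt_0_compat; trivial. now apply pow_lt. }
  exists T. split; trivial. intros t Ht. specialize (HT t Ht).
  rewrite Rminus_0_r in *. rewrite Rabs_pos_eq in HT.
  2:{ apply Rmult_le_pos; [lra | apply pow2_ge_0]. }
  apply Rmult_lt_reg_l in HT; trivial.
  rewrite <- (Rabs_pos_eq e) by lra. apply Rsqr_lt_abs_0. unfold Rsqr. lra. }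
apply (limit_at_only_zero G P lo c a).
- intros z; now apply (lipschitz_continuous K).
- intros z Hz Ez. destruct (Rtotal_order z a) as [Hza|[Hza|Hza]]; trivial; exfalso.
  + assert (W := G_left z ltac:(lra) Hza). lra.
  + assert (W := G_mid z Hza ltac:(lra)). lra.
- intros t Ht. assert (R := range t Ht). specialize (Hc t Ht). lra.
- apply (force_vanishes (- alpha) G P p K M Y); trivial.
Qed.

Lemma heteroclinic_orbit :
  exists P p : R -> R, (forall y, oscillator (- alpha) G P p y) /\ (forall y, lo < P y <= b) /\
    is_lim P m_infty b /\ is_lim P p_infty a.
Proof.
destruct unstable_manifold as (P & p & H0 & H & HP & LP & Lp).
destruct (forward_limit P p H0 H (energy_below_saddle P p H0 H LP Lp)) as [R La].
exists P, p. split; trivial. split; [|split; trivial].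
- intros y. destruct (Rle_dec 0 y) as [Hy|Hy].
  + specialize (R y Hy). lra.
  + specialize (HP (- y) ltac:(lra)). rewrite Ropp_involutive in HP. lra.
- apply (is_lim_ext (fun t => P (- - t))). { intros t; now rewrite Ropp_involutive. }
  apply (is_lim_comp (fun t => P (- t)) Ropp m_infty b p_infty); trivial.
  + apply (is_lim_opp (fun t => t) m_infty m_infty), is_lim_id.
  + exists 0. intros y _. discriminate.
Qed.
End Heteroclinic.

(** * Removing the truncation *)

Definition clamp (lo hi z : R) := Rmax lo (Rmin hi z).

Lemma clamp_range lo hi z : lo <= hi -> lo <= clamp lo hi z <= hi.
Proof.
intros H. unfold clamp. split; [apply Rmax_l|]. apply Rmax_lub; trivial. apply Rmin_l.
Qed.

Lemma clamp_id lo hi z : lo <= z <= hi -> clamp lo hi z = z.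
Proof. intros H. unfold clamp. rewrite Rmin_right, Rmax_right; lra. Qed.

Lemma clamp_lipschitz lo hi u v : Rabs (clamp lo hi u - clamp lo hi v) <= Rabs (u - v).
Proof.
unfold clamp, Rmax, Rmin. repeat destruct Rle_dec; unfold Rabs; repeat destruct Rcase_abs; lra.
Qed.

Lemma C1_clamp_lipschitz (F F' : R -> R) lo hi :
  lo <= hi -> (forall z, lo <= z <= hi -> is_derive F z (F' z)) ->
  (forall z, lo <= z <= hi -> continuous F' z) ->
  exists K M, 0 <= K /\ lipschitz K (fun z => F (clamp lo hi z)) /\
    forall z, Rabs (F (clamp lo hi z)) <= M.
Proof.
intros Hlh HF HF'.
destruct (continuity_ab_maj (fun z => Rabs (F' z)) lo hi Hlh) as [k [Hk _]].
{ intros c Hc. apply continuity_pt_filterlim, (continuous_comp F' Rabs).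
  now apply HF'. apply continuous_Rabs. }
destruct (continuity_ab_maj (fun z => Rabs (F z)) lo hi Hlh) as [m [Hm _]].
{ intros c Hc. apply continuity_pt_filterlim, (continuous_comp F Rabs).
  eapply is_derive_continuous, HF, Hc. apply continuous_Rabs. }
exists (Rabs (F' k)), (Rabs (F m)). split; [apply Rabs_pos|]. split.
- assert (W : forall u v, lo <= u -> u <= v -> v <= hi -> Rabs (F v - F u) <= Rabs (F' k) * Rabs (v - u)).
  { intros u v Hu Huv Hv. destruct (mean_value F F' u v Huv) as [c [Hc E]].
    { intros x Hx; apply HF; lra. }
    rewrite E, Rabs_mult. apply Rmult_le_compat_r; [apply Rabs_pos|]. apply Hk; lra. }
  intros u v. eapply Rle_trans.
  2:{ apply Rmult_le_compat_l; [apply Rabs_pos | apply (clamp_lipschitz lo hi)]. }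
  assert (Hu := clamp_range lo hi u Hlh). assert (Hv := clamp_range lo hi v Hlh).
  destruct (Rle_dec (clamp lo hi u) (clamp lo hi v)).
  + rewrite Rabs_minus_sym, (Rabs_minus_sym (clamp lo hi u)). apply W; lra.
  + apply W; lra.
- intros z. apply Hm, clamp_range, Hlh.
Qed.

(** The orbit of the force truncated to [lo, b + 1] stays in (lo, b], where the
    truncation changes nothing. On [lo, b] the truncated potential W differs
    from V by a constant, so the barrier condition carries over. The margin
    beyond b keeps the force positive there, as the maximum principle
    requires. *)
Lemma damped_heteroclinic alpha lo a b (F F' V : R -> R) :
  0 < alpha -> 0 < lo < a -> a < b ->
  (forall z, 0 < z -> is_derive F z (F' z)) -> (forall z, 0 < z -> continuous F' z) ->
  (forall z, 0 < z -> is_derive V z (- F z)) ->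
  (forall z, 0 < z < a -> 0 < F z) -> (forall z, a < z < b -> F z < 0) ->
  (forall z, b < z -> 0 < F z) -> V b <= V lo ->
  exists P p : R -> R, (forall y, 0 < P y) /\ (forall y, oscillator (- alpha) F P p y) /\
    is_lim P m_infty b /\ is_lim P p_infty a.
Proof.
intros Halpha Hlo Hab HF HF' HV F1 F2 F3 Hbar.
destruct (C1_clamp_lipschitz F F' lo (b + 1)) as (K & M & HK & HG & HM).
{ lra. } { intros z Hz; apply HF; lra. } { intros z Hz; apply HF'; lra. }
set (G := fun z => F (clamp lo (b + 1) z)) in *.
assert (EG : forall z, lo <= z <= b + 1 -> G z = F z).
{ intros z Hz. unfold G. now rewrite clamp_id. }
set (W := fun z => RInt (fun r => - G r) lo z).
assert (DW : forall z, is_derive W z (- G z)).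
{ intros z. apply (is_derive_ext (fun z => 0 + RInt (fun r => - G r) lo z)).
  { intros t; apply Rplus_0_l. }
  replace (- G z) with (0 + - G z) by ring. apply (is_derive_plus (fun _ => 0)).
  { apply (is_derive_const 0 z). }
  assert (cG : forall r, continuous (fun r => - G r) r).
  { intros r. apply (continuous_opp G), (lipschitz_continuous K); trivial. }
  apply (is_derive_RInt (fun r => - G r) _ lo); [|apply cG].
  exists (mkposreal 1 Rlt_0_1). intros y _. apply (RInt_correct (fun r => - G r)).
  apply (ex_RInt_continuous (fun r => - G r)); intros; apply cG. }
destruct (heteroclinic_orbit alpha K M lo a b G W) as (P & p & H & HP & L1 & L2); trivial; try lra.
- intros z Hz Hza. rewrite EG by lra. apply F1; lra.
- intros z Hz Hzb. rewrite EG by lra. apply F2; lra.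
- intros z Hz. unfold G. apply F3. unfold clamp. eapply Rlt_le_trans; [|apply Rmax_r].
  apply Rmin_glb_lt; lra.
- destruct (mean_value (fun z => W z - V z) (fun z => - G z - - F z) lo b) as [c [Hc E]].
  + lra.
  + intros z Hz. apply (is_derive_minus W V). apply DW. apply HV; lra.
  + rewrite EG in E by lra. lra.
- exists P, p. split; [|split; [|split; trivial]].
  + intros y. specialize (HP y). lra.
  + intros y. destruct (H y) as [H1 H2]. split; trivial.
    specialize (HP y). rewrite EG in H2 by lra. exact H2.
Qed.

(** * Smoothness *)

(** Derivatives are provided as functions rather than by [Derive], so that
    closure under the operations follows by induction on the order alone. *)
Fixpoint differentiable_upto (n : nat) (f : R -> R) : Prop :=
  match n with
  | O => True
  | S m => exists f', (forall x, is_derive f x (f' x)) /\ differentiable_upto m f'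
  end.

Lemma differentiable_upto_smooth f : (forall n, differentiable_upto n f) -> smooth f.
Proof.
assert (W : forall n f, differentiable_upto (S n) f -> forall x, ex_derive (Derive_n f n) x).
{ induction n; intros h [h' [Hh Hh']] x.
  - now exists (h' x).
  - apply (ex_derive_ext (Derive_n h' n)).
    + intros y. rewrite (Derive_n_ext h' (Derive_n h 1)).
      * rewrite Derive_n_comp. now rewrite Nat.add_1_r.
      * intros z. symmetry. apply is_derive_unique, Hh.
    + now apply IHn. }
intros H [|n] x; simpl; trivial. apply W, H.
Qed.

Lemma differentiable_upto_pred n f : differentiable_upto (S n) f -> differentiable_upto n f.
Proof.
revert f; induction n; intros f H; [exact I|].
destruct H as [f' [Hf Hf']]. exists f'. split; trivial. now apply IHn.
Qed.

Lemma differentiable_upto_const n c : differentiable_upto n (fun _ => c).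
Proof.
revert c; induction n; intros c; [exact I|].
exists (fun _ => 0). split; [intros x; apply (is_derive_const c x) | apply IHn].
Qed.

Lemma differentiable_upto_plus n f g :
  differentiable_upto n f -> differentiable_upto n g -> differentiable_upto n (fun x => f x + g x).
Proof.
revert f g; induction n; intros f g Hf Hg; [exact I|].
destruct Hf as [f' [Hf Hf']]. destruct Hg as [g' [Hg Hg']].
exists (fun x => f' x + g' x). split; [|now apply IHn].
intros x. apply (is_derive_plus f g); trivial.
Qed.

Lemma differentiable_upto_mult n f g :
  differentiable_upto n f -> differentiable_upto n g -> differentiable_upto n (fun x => f x * g x).
Proof.
revert f g; induction n; intros f g Hf Hg; [exact I|].
assert (Pf := differentiable_upto_pred n f Hf). assert (Pg := differentiable_upto_pred n g Hg).
destruct Hf as [f' [Hf Hf']]. destruct Hg as [g' [Hg Hg']].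
exists (fun x => f' x * g x + f x * g' x). split.
- intros x. apply (is_derive_mult f g); trivial. intros; apply Rmult_comm.
- apply differentiable_upto_plus; now apply IHn.
Qed.

Lemma differentiable_upto_exp n f :
  differentiable_upto n f -> differentiable_upto n (fun x => exp (f x)).
Proof.
revert f; induction n; intros f H; [exact I|].
assert (Pf := differentiable_upto_pred n f H). destruct H as [f' [Hf Hf']].
exists (fun x => f' x * exp (f x)). split.
- intros x. apply (is_derive_comp exp f); trivial. apply is_derive_exp.
- apply differentiable_upto_mult; trivial. now apply IHn.
Qed.

Lemma differentiable_upto_inv n f : (forall x, f x <> 0) ->
  differentiable_upto n f -> differentiable_upto n (fun x => / f x).
Proof.
intros H0. induction n; intros H; [exact I|].
assert (Pf := IHn (differentiable_upto_pred n f H)). destruct H as [f' [Hf Hf']].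
exists (fun x => (-1 * f' x) * (/ f x * / f x)). split.
- intros x. replace (-1 * f' x * (/ f x * / f x)) with (- f' x / f x ^ 2) by (now field).
  now apply is_derive_inv.
- apply differentiable_upto_mult; apply differentiable_upto_mult; trivial.
  apply differentiable_upto_const.
Qed.

Lemma differentiable_upto_ln n f : (forall x, 0 < f x) ->
  differentiable_upto n f -> differentiable_upto n (fun x => ln (f x)).
Proof.
intros H0 H. destruct n; [exact I|].
assert (Pf := differentiable_upto_pred n f H). destruct H as [f' [Hf Hf']].
exists (fun x => f' x * / f x). split.
- intros x. apply (is_derive_comp ln f); trivial. now apply is_derive_ln.
- apply differentiable_upto_mult; trivial. apply differentiable_upto_inv; trivial.
  intros x. specialize (H0 x). lra.
Qed.

(** * Barotropic gas dynamics *)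

Lemma enthalpy_derive gamma rho : 0 < rho ->
  is_derive (enthalpy gamma) rho (gamma * Rpower rho (gamma - 2)).
Proof.
intros Hr. unfold enthalpy. destruct (Req_EM_T gamma 1) as [->|Hne].
- replace (1 * Rpower rho (1 - 2)) with (/ rho). { now apply is_derive_ln. }
  replace (1 - 2) with (- (1)) by ring. rewrite Rpower_Ropp, Rpower_1 by trivial. ring.
- replace (gamma * Rpower rho (gamma - 2)) with
    (gamma / (gamma - 1) * ((gamma - 1) * / rho * Rpower rho (gamma - 1))).
  + apply (is_derive_scal (fun r => Rpower r (gamma - 1))). unfold Rpower.
    auto_derive; trivial. ring.
  + replace (gamma - 1) with (gamma - 2 + 1) at 3 by ring.
    rewrite Rpower_plus, Rpower_1 by trivial. field. lra.
Qed.

Lemma sound_speed_eq gamma rho : 0 < rho ->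
  sound_speed gamma rho = sqrt (gamma * Rpower rho (gamma - 1)).
Proof.
intros Hr. unfold sound_speed.
rewrite (is_derive_unique _ _ _ (enthalpy_derive gamma rho Hr)). f_equal.
replace (gamma - 1) with (gamma - 2 + 1) by ring. rewrite Rpower_plus, Rpower_1 by trivial. ring.
Qed.

Lemma differentiable_upto_enthalpy gamma n f : (forall x, 0 < f x) ->
  differentiable_upto n f -> differentiable_upto n (fun x => enthalpy gamma (f x)).
Proof.
intros H0 H. unfold enthalpy. destruct (Req_EM_T gamma 1).
- now apply differentiable_upto_ln.
- apply differentiable_upto_mult; [apply differentiable_upto_const|]. unfold Rpower.
  apply differentiable_upto_exp, differentiable_upto_mult; [apply differentiable_upto_const|].
  now apply differentiable_upto_ln.
Qed.

Definition enthalpy_primitive (gamma rho : R) : R :=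
  if Req_EM_T gamma 1 then rho * ln rho - rho else / (gamma - 1) * Rpower rho gamma.

Lemma enthalpy_primitive_derive gamma rho : 0 < rho ->
  is_derive (enthalpy_primitive gamma) rho (enthalpy gamma rho).
Proof.
intros Hr. unfold enthalpy_primitive, enthalpy. destruct (Req_EM_T gamma 1) as [->|Hne].
- auto_derive; trivial. field. lra.
- replace (gamma / (gamma - 1) * Rpower rho (gamma - 1)) with
    (/ (gamma - 1) * (gamma * / rho * Rpower rho gamma)).
  + apply (is_derive_scal (fun r => Rpower r gamma)). unfold Rpower.
    auto_derive; trivial. ring.
  + replace gamma with (gamma - 1 + 1) at 3 by ring.
    rewrite Rpower_plus, Rpower_1 by trivial. field. lra.
Qed.

(** Near vacuum this primitive stays below a constant, so it cannot
    compensate the term A^2 / (4 P^2) of the potential. *)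
Lemma enthalpy_primitive_bounded gamma : 1 <= gamma ->
  exists C, forall rho, 0 < rho <= 1 -> enthalpy_primitive gamma rho <= C.
Proof.
intros Hg. unfold enthalpy_primitive. destruct (Req_EM_T gamma 1) as [->|Hne].
- exists 0. intros rho Hr.
  assert (ln rho <= 0). { rewrite <- ln_1. apply ln_le; lra. } nra.
- exists (/ (gamma - 1) * 1). intros rho Hr. apply Rmult_le_compat_l.
  + left. apply Rinv_0_lt_compat. lra.
  + replace 1 with (Rpower 1 gamma) by (unfold Rpower; rewrite ln_1, Rmult_0_r; apply exp_0).
    apply Rle_Rpower_l; lra.
Qed.

(** In the frame of the wave the velocity is A / rho, so this is Bernoulli's
    quantity v^2 / 2 + h minus its common value B at the end states. *)
Definition bernoulli (gamma A B rho : R) : R := A^2 / (2 * rho^2) + enthalpy gamma rho - B.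

Lemma bernoulli_derive gamma A B rho : 0 < rho ->
  is_derive (bernoulli gamma A B) rho ((gamma * Rpower rho (gamma + 1) - A^2) / rho^3).
Proof.
intros Hr. unfold bernoulli. auto_derive.
{ split; [nra|]. split; trivial. eexists; now apply enthalpy_derive. }
replace (Derive (fun x : R => enthalpy gamma x) rho) with (gamma * Rpower rho (gamma - 2))
  by (symmetry; apply is_derive_unique; now apply enthalpy_derive).
replace (gamma + 1) with (gamma - 2 + INR 3) by (simpl; ring).
rewrite Rpower_plus, Rpower_pow by trivial. field. lra.
Qed.

Section AmplitudeConnection.
Variables (gamma A B ra rb : R).
Hypothesis gamma_ge_1 : 1 <= gamma.
Hypothesis ra_pos : 0 < ra.
Hypothesis rb_pos : 0 < rb.
Hypothesis ra_super : gamma * Rpower ra (gamma + 1) < A^2.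
Hypothesis rb_sub : A^2 < gamma * Rpower rb (gamma + 1).
Hypothesis ra_zero : bernoulli gamma A B ra = 0.
Hypothesis rb_zero : bernoulli gamma A B rb = 0.

Lemma flux_power_lt u v : 0 < u -> u < v ->
  gamma * Rpower u (gamma + 1) < gamma * Rpower v (gamma + 1).
Proof.
intros Hu Huv. apply Rmult_lt_compat_l; [lra|]. apply Rlt_Rpower_l; lra.
Qed.

Lemma supersonic_density_lt : ra < rb.
Proof.
apply Rnot_le_lt. intros Hn. destruct (Rle_lt_or_eq_dec rb ra Hn) as [H|E].
- assert (W := flux_power_lt rb ra rb_pos H). lra.
- rewrite E in rb_sub. lra.
Qed.

Lemma bernoulli_decreasing u v : 0 < u -> u < v -> gamma * Rpower v (gamma + 1) <= A^2 -> bernoulli gamma A B v < bernoulli gamma A B u.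
Proof.
intros Hu Huv H.
destruct (MVT_cor2 (bernoulli gamma A B)
  (fun rho => (gamma * Rpower rho (gamma + 1) - A^2) / rho^3) u v Huv) as [c [E Hc]].
{ intros x Hx. apply is_derive_Reals, bernoulli_derive. lra. }
assert (W := flux_power_lt c v ltac:(lra) ltac:(lra)).
assert (Hc3 : 0 < / c^3) by (apply Rinv_0_lt_compat, pow_lt; lra).
unfold Rdiv in E. assert ((gamma * Rpower c (gamma + 1) - A ^ 2) * / c ^ 3 < 0) by nra. nra.
Qed.

Lemma bernoulli_increasing u v : 0 < u -> u < v -> A^2 <= gamma * Rpower u (gamma + 1) -> bernoulli gamma A B u < bernoulli gamma A B v.
Proof.
intros Hu Huv H.
destruct (MVT_cor2 (bernoulli gamma A B)
  (fun rho => (gamma * Rpower rho (gamma + 1) - A^2) / rho^3) u v Huv) as [c [E Hc]].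
{ intros x Hx. apply is_derive_Reals, bernoulli_derive. lra. }
assert (W := flux_power_lt u c ltac:(lra) ltac:(lra)).
assert (Hc3 : 0 < / c^3) by (apply Rinv_0_lt_compat, pow_lt; lra).
unfold Rdiv in E. assert (0 < (gamma * Rpower c (gamma + 1) - A ^ 2) * / c ^ 3) by nra. nra.
Qed.

Lemma bernoulli_pos_left r : 0 < r < ra -> 0 < bernoulli gamma A B r.
Proof.
intros Hr. rewrite <- ra_zero. apply bernoulli_decreasing; lra.
Qed.

Lemma bernoulli_pos_right r : rb < r -> 0 < bernoulli gamma A B r.
Proof.
intros Hr. rewrite <- rb_zero. apply bernoulli_increasing; lra.
Qed.

Lemma bernoulli_neg_between r : ra < r < rb -> bernoulli gamma A B r < 0.
Proof.
intros Hr. destruct (Rle_dec (gamma * Rpower r (gamma + 1)) (A^2)) as [H|H].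
- rewrite <- ra_zero. apply bernoulli_decreasing; lra.
- rewrite <- rb_zero. apply bernoulli_increasing; lra.
Qed.

(** The damped connection for the force of the amplitude equation. Its
    potential is explicit: the integral of z h(z^2) is half of
    enthalpy_primitive at z^2. *)
Lemma amplitude_heteroclinic k alpha : 0 < k -> 0 < alpha ->
  exists P p : R -> R, (forall y, 0 < P y) /\
    (forall y, oscillator (- alpha) (fun z => z * bernoulli gamma A B (z^2) / k^2) P p y) /\
    is_lim P m_infty (sqrt rb) /\ is_lim P p_infty (sqrt ra).
Proof.
intros Hk Ha.
assert (Hab := supersonic_density_lt).
assert (Sa := sqrt_lt_R0 ra ra_pos). assert (Sb := sqrt_lt_R0 rb rb_pos).
assert (Qa : sqrt ra * sqrt ra = ra) by (apply sqrt_sqrt; lra).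
assert (Qb : sqrt rb * sqrt rb = rb) by (apply sqrt_sqrt; lra).
assert (Sab : sqrt ra < sqrt rb) by (apply sqrt_lt_1; lra).
assert (Hk2 : 0 < / k^2) by (apply Rinv_0_lt_compat, pow_lt; lra).
assert (HA2 : 0 < A^2).
{ eapply Rle_lt_trans; [|apply ra_super]. apply Rmult_le_pos; [lra|]. left; apply exp_pos. }
set (V := fun z => (A^2 / (4 * z^2) - enthalpy_primitive gamma (z^2) / 2 + B * z^2 / 2) / k^2).
destruct (enthalpy_primitive_bounded gamma gamma_ge_1) as [C HC].
(* The barrier [lo = / q] is so close to vacuum that the term [A^2 / (4 lo^2)]
   of [k^2 V lo] is at least [D], which bounds everything else. *)
set (D := Rabs (k^2 * V (sqrt rb)) + Rabs C + Rabs B).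
assert (HD : 0 <= D).
{ unfold D. assert (X1 := Rabs_pos (k^2 * V (sqrt rb))). assert (X2 := Rabs_pos C).
  assert (X3 := Rabs_pos B). lra. }
set (q := 1 + 1 / sqrt ra + 4 * D / A^2).
assert (q1 : 0 < 1 / sqrt ra) by (apply Rdiv_lt_0_compat; lra).
assert (q2 : 0 <= 4 * D / A^2) by (apply Rdiv_le_0_compat; lra).
assert (Hq : 1 <= q) by (unfold q; lra).
assert (Hlo : 0 < / q) by (apply Rinv_0_lt_compat; lra).
apply (damped_heteroclinic alpha (/ q) (sqrt ra) (sqrt rb) _
  (fun z => (bernoulli gamma A B (z^2) + 2 * (gamma * Rpower (z^2) (gamma + 1) - A^2) / z^4) / k^2) V);
  trivial.
- split; trivial. replace (sqrt ra) with (/ (1 / sqrt ra)) by (field; lra).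
  apply Rinv_lt_contravar; [apply Rmult_lt_0_compat; lra | unfold q; lra].
- intros z Hz. assert (Hz2 : 0 < z^2) by now apply pow_lt.
  auto_derive. { eexists; exact (bernoulli_derive gamma A B (z^2) Hz2). }
  replace (Derive (fun x => bernoulli gamma A B x) (z * (z * 1))) with
    ((gamma * Rpower (z^2) (gamma + 1) - A^2) / (z^2)^3)
    by (symmetry; apply is_derive_unique, (bernoulli_derive gamma A B (z^2) Hz2)).
  simpl pow. field. split; apply Rgt_not_eq; lra.
- intros z Hz. assert (Hz2 : 0 < z^2) by now apply pow_lt.
  apply (ex_derive_continuous (fun z => (bernoulli gamma A B (z^2) + 2 * (gamma * Rpower (z^2) (gamma + 1) - A^2) / z^4) / k^2)).
  unfold Rpower. auto_derive.
  split; [eexists; now apply bernoulli_derive|]. simpl in *. split; trivial. split; trivial.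
  apply Rgt_not_eq. rewrite Rmult_1_r. repeat apply Rmult_lt_0_compat; trivial.
- intros z Hz. assert (Hz2 : 0 < z^2) by now apply pow_lt. unfold V.
  auto_derive.
  { split; [simpl in *; apply Rgt_not_eq; lra|]. split; trivial.
    eexists; now apply enthalpy_primitive_derive. }
  replace (Derive (fun x => enthalpy_primitive gamma x) (z * (z * 1))) with (enthalpy gamma (z^2))
    by (symmetry; apply is_derive_unique; now apply enthalpy_primitive_derive).
  unfold bernoulli. field. split; apply Rgt_not_eq; lra.
- intros z Hz. apply Rmult_lt_0_compat; trivial. apply Rmult_lt_0_compat; [lra|].
  apply bernoulli_pos_left. simpl. nra.
- intros z Hz. assert (bernoulli gamma A B (z^2) < 0) by (apply bernoulli_neg_between; simpl; nra).
  unfold Rdiv. assert (z * bernoulli gamma A B (z^2) < 0) by nra. nra.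
- intros z Hz. apply Rmult_lt_0_compat; trivial. apply Rmult_lt_0_compat; [lra|].
  apply bernoulli_pos_right. simpl. nra.
- assert (Hq2 : 0 < (/ q)^2 <= 1).
  { split; [now apply pow_lt|]. rewrite <- (pow1 2). apply pow_incr. split; [lra|].
    rewrite <- Rinv_1. apply Rinv_le_contravar; lra. }
  specialize (HC _ Hq2).
  assert (X1 := Rle_abs (k^2 * V (sqrt rb))). assert (X2 := Rle_abs C). assert (X3 := Rabs_pos C).
  assert (X4 := Rle_abs (- B)). rewrite Rabs_Ropp in X4. assert (X5 := Rabs_pos B).
  assert (E1 : D <= A^2 / (4 * (/ q)^2)).
  { replace (A^2 / (4 * (/ q)^2)) with (A^2 / 4 * (q * q)) by (field; lra).
    apply (Rle_trans _ (A^2 / 4 * q)).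
    - replace D with (A^2 / 4 * (4 * D / A^2)) by (field; intros E; rewrite E in HA2; simpl in HA2; lra).
      apply Rmult_le_compat_l; [lra|]. unfold q; lra.
    - apply Rmult_le_compat_l; [lra|]. nra. }
  assert (E2 : k^2 * V (sqrt rb) <= k^2 * V (/ q)).
  { unfold V at 2. set (h := enthalpy_primitive gamma ((/ q)^2)) in *.
    replace (k^2 * ((A^2 / (4 * (/ q)^2) - h / 2 + B * (/ q)^2 / 2) / k^2)) with
      (A^2 / (4 * (/ q)^2) - h / 2 + B * (/ q)^2 / 2) by (field; lra).
    assert (- Rabs B <= B * (/ q)^2) by nra. unfold D in E1. lra. }
  apply Rmult_le_reg_l in E2; trivial. now apply pow_lt.
Qed.
End AmplitudeConnection.

(** * From the orbit to the traveling wave *)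

(** Bootstrap: the equation expresses the derivative of p through P and p
    themselves, so each gains one order of differentiability in turn. *)
Lemma amplitude_smooth gamma A B k beta P p :
  (forall y, 0 < P y) ->
  (forall y, oscillator beta (fun z => z * bernoulli gamma A B (z^2) / k^2) P p y) ->
  forall n, differentiable_upto n P /\ differentiable_upto n p.
Proof.
intros HP H n. induction n as [|n [IP Ip]]; [now split|].
split.
- exists p. split; trivial. intros y; apply H.
- exists (fun y => beta * p y + P y * bernoulli gamma A B (P y ^ 2) * / k^2).
  split. { intros y; apply H. }
  assert (I2 : differentiable_upto n (fun y => P y ^ 2)).
  { simpl. apply differentiable_upto_mult; trivial.
    apply differentiable_upto_mult; trivial. apply differentiable_upto_const. }
  assert (HP2 : forall y, 0 < P y ^ 2) by (intros y; apply pow_lt, HP).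
  apply differentiable_upto_plus.
  { apply differentiable_upto_mult; trivial. apply differentiable_upto_const. }
  apply differentiable_upto_mult; [|apply differentiable_upto_const].
  apply differentiable_upto_mult; trivial.
  unfold bernoulli. apply differentiable_upto_plus; [|apply differentiable_upto_const].
  apply differentiable_upto_plus; [|now apply differentiable_upto_enthalpy].
  apply differentiable_upto_mult; [apply differentiable_upto_const|].
  apply differentiable_upto_inv.
  { intros y. specialize (HP2 y). assert (0 < (P y ^ 2)^2) by now apply pow_lt. lra. }
  apply differentiable_upto_mult; [apply differentiable_upto_const|].
  simpl pow at 1. apply differentiable_upto_mult; trivial.
  apply differentiable_upto_mult; trivial. apply differentiable_upto_const.
Qed.

Lemma wave_derive_x f f' s eps t x : eps <> 0 -> (forall y, is_derive f y (f' y)) ->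
  Derive (fun x => f ((x - s * t) / eps)) x = f' ((x - s * t) / eps) / eps.
Proof.
intros He Hf. apply is_derive_unique. auto_derive. { now exists (f' ((x - s * t) / eps)). }
replace (Derive (fun x => f x) ((x + - (s * t)) * / eps)) with (f' ((x - s * t) / eps))
  by (symmetry; apply is_derive_unique, Hf).
field; trivial.
Qed.

Lemma wave_derive_t f f' s eps t x : eps <> 0 -> (forall y, is_derive f y (f' y)) ->
  Derive (fun t => f ((x - s * t) / eps)) t = - s * f' ((x - s * t) / eps) / eps.
Proof.
intros He Hf. apply is_derive_unique. auto_derive. { now exists (f' ((x - s * t) / eps)). }
replace (Derive (fun x => f x) ((x + - (s * t)) * / eps)) with (f' ((x - s * t) / eps))
  by (symmetry; apply is_derive_unique, Hf).
field; trivial.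
Qed.

(** The viscous term differentiates 2 s p / P because rho u = s rho + A, and the
    dispersive one differentiates p' / P. By the equation, their combination
    is the derivative of g(P^2), whose enthalpy part is the pressure term and
    whose A^2 part is the inertia. *)
Lemma amplitude_orbit_solves gamma mu k eps s A B (P p : R -> R) :
  0 < k -> 0 < eps -> (forall y, 0 < P y) ->
  (forall y, oscillator (- (2 * mu * s / k^2)) (fun z => z * bernoulli gamma A B (z^2) / k^2) P p y) ->
  solves_viscous_dispersive_system gamma mu k eps
    (fun t x => P ((x - s * t) / eps) ^ 2)
    (fun t x => s + A / P ((x - s * t) / eps) ^ 2).
Proof.
intros Hk He HP H.
assert (Hk' : k <> 0) by lra. assert (He' : eps <> 0) by lra.
assert (HP' : forall y, P y <> 0) by (intros y; specialize (HP y); lra).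
set (q := fun y => - (2 * mu * s / k^2) * p y + P y * bernoulli gamma A B (P y ^ 2) / k^2).
assert (DP : forall y, is_derive P y (p y)) by apply H.
assert (Dp : forall y, is_derive p y (q y)) by apply H.
assert (eP : forall y, Derive (fun x => P x) y = p y) by (intros; apply is_derive_unique, DP).
assert (ep : forall y, Derive (fun x => p x) y = q y) by (intros; apply is_derive_unique, Dp).
assert (xP : forall y, ex_derive (fun x => P x) y) by (intros y; exists (p y); apply DP).
assert (xp : forall y, ex_derive (fun x => p x) y) by (intros y; exists (q y); apply Dp).
assert (HP2 : forall y, 0 < P y ^ 2) by (intros y; apply pow_lt, HP).
assert (Drho : forall y, is_derive (fun y => P y ^ 2) y (2 * P y * p y)).
{ intros y. auto_derive; [apply xP|]. rewrite eP; ring. }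
assert (Dflux : forall y, is_derive (fun y => P y ^ 2 * (s + A / P y ^ 2)) y (2 * s * P y * p y)).
{ intros y.
  assert (E : forall z, s * P z ^ 2 + A = P z ^ 2 * (s + A / P z ^ 2)) by (intros z; now field).
  apply (is_derive_ext _ _ _ _ E).
  auto_derive; [apply xP|]. rewrite eP; ring. }
assert (Du : forall y, is_derive (fun y => s + A / P y ^ 2) y (- (2 * A * p y) / P y ^ 3)).
{ intros y. auto_derive. { split; [apply xP|]. split; trivial. specialize (HP2 y). simpl in HP2. lra. }
  rewrite eP. now field. }
assert (Du2 : forall y, is_derive (fun y => (s + A / P y ^ 2) ^ 2) y
   (2 * (s + A / P y ^ 2) * (- (2 * A * p y) / P y ^ 3))).
{ intros y. auto_derive. { split; [apply xP|]. split; trivial. specialize (HP2 y). simpl in HP2. lra. }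
  rewrite eP. now field. }
set (h' := fun y => gamma * Rpower (P y ^ 2) (gamma - 2)).
assert (Dh : forall y, is_derive (fun y => enthalpy gamma (P y ^ 2)) y (h' y * (2 * P y * p y))).
{ intros y. rewrite Rmult_comm. apply (is_derive_comp (enthalpy gamma) (fun y => P y ^ 2)); [|apply Drho].
  now apply enthalpy_derive. }
assert (Dvisc : forall y, is_derive (fun y => 2 * s * p y / P y / eps) y
   (2 * s * (q y / P y - p y ^ 2 / P y ^ 2) / eps)).
{ intros y. auto_derive. { repeat split; trivial. }
  rewrite eP, ep. now field. }
assert (Ddisp : forall y, is_derive (fun y => q y / P y / eps^2) y
   ((- (2 * mu * s) * (q y / P y - p y ^ 2 / P y ^ 2)
      + h' y * (2 * P y * p y) - 2 * A^2 * p y / P y ^ 5) / (k^2 * eps^2))).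
{ intros y.
  assert (E : forall z, (- (2 * mu * s) * (p z / P z) + (A^2 / (2 * (P z ^ 2)^2) - B)
      + enthalpy gamma (P z ^ 2)) / (k^2 * eps^2) = q z / P z / eps^2).
  { intros z. unfold q, bernoulli. field. repeat split; trivial. }
  apply (is_derive_ext _ _ _ _ E).
  auto_derive.
  { assert (N : 2 * (P y ^ 2)^2 <> 0).
    { apply Rgt_not_eq. apply Rmult_lt_0_compat; [lra | apply (pow_lt (P y ^ 2) 2), HP2]. }
    assert (X : ex_derive (fun x => enthalpy gamma x) (P y ^ 2)).
    { eexists. apply enthalpy_derive, HP2. }
    repeat split; trivial. }
  replace (Derive (fun x => enthalpy gamma x) (P y * (P y * 1))) with (h' y).
  2:{ symmetry; apply is_derive_unique. apply (enthalpy_derive gamma (P y ^ 2)), HP2. }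
  rewrite eP, ep. field. repeat split; trivial. }
intros t x. set (y := (x - s * t) / eps).
assert (Esqrt : forall x, sqrt (P ((x - s * t) / eps) ^ 2) = P ((x - s * t) / eps)).
{ intros z. apply sqrt_pow2. left; apply HP. }
split.
- rewrite (wave_derive_t (fun y => P y ^ 2) _ s eps t x He' Drho).
  rewrite (wave_derive_x (fun y => P y ^ 2 * (s + A / P y ^ 2)) _ s eps t x He' Dflux).
  field; trivial.
- rewrite (wave_derive_t (fun y => s + A / P y ^ 2) _ s eps t x He' Du).
  rewrite (wave_derive_x (fun y => (s + A / P y ^ 2) ^ 2) _ s eps t x He' Du2).
  rewrite (wave_derive_x (fun y => enthalpy gamma (P y ^ 2)) _ s eps t x He' Dh).
  rewrite (Derive_ext (fun x' => Derive (fun x'' => P ((x'' - s * t) / eps) ^ 2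
      * (s + A / P ((x'' - s * t) / eps) ^ 2)) x' / P ((x' - s * t) / eps) ^ 2)
    (fun x' => 2 * s * p ((x' - s * t) / eps) / P ((x' - s * t) / eps) / eps)).
  2:{ intros z. rewrite (wave_derive_x (fun y => P y ^ 2 * (s + A / P y ^ 2)) _ s eps t z He' Dflux).
      field; split; trivial. }
  rewrite (wave_derive_x (fun y => 2 * s * p y / P y / eps) _ s eps t x He' Dvisc).
  rewrite (Derive_ext (fun x' => Derive_n (fun x'' => sqrt (P ((x'' - s * t) / eps) ^ 2)) 2 x'
      / sqrt (P ((x' - s * t) / eps) ^ 2))
    (fun x' => q ((x' - s * t) / eps) / P ((x' - s * t) / eps) / eps^2)).
  2:{ intros z. rewrite Esqrt, (Derive_n_ext _ _ 2 z Esqrt). change (Derive_n ?f 2 z) with (Derive (Derive f) z).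
      rewrite (Derive_ext _ (fun z => p ((z - s * t) / eps) / eps)).
      2:{ intros w. apply (wave_derive_x P p); trivial. }
      rewrite (wave_derive_x (fun y => p y / eps) (fun y => q y / eps)); trivial.
      { field; split; trivial. }
      intros w. auto_derive; [apply xp|]. rewrite ep. now field. }
  rewrite (wave_derive_x (fun y => q y / P y / eps^2) _ s eps t x He' Ddisp).
  fold y. field. repeat split; trivial.
Qed.

Lemma amplitude_orbit_profile gamma mu k eps s B Wm Wp (P p : R -> R) :
  0 < k -> 0 < eps -> 0 < density Wm -> 0 < density Wp -> (forall y, 0 < P y) ->
  density Wm * (velocity Wm - s) = density Wp * (velocity Wp - s) ->
  (forall y, oscillator (- (2 * mu * s / k^2))
     (fun z => z * bernoulli gamma (density Wp * (velocity Wp - s)) B (z^2) / k^2) P p y) ->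
  is_lim P m_infty (sqrt (density Wm)) -> is_lim P p_infty (sqrt (density Wp)) ->
  traveling_wave_profile gamma mu k eps s Wm Wp P
    (fun y => s + density Wp * (velocity Wp - s) / P y ^ 2).
Proof.
intros Hk He Hm Hp HP HA H Lm Lp.
set (A := density Wp * (velocity Wp - s)) in *.
assert (sm := amplitude_smooth gamma A B k _ P p HP H).
assert (HP2 : forall y, 0 < P y ^ 2) by (intros y; apply pow_lt, HP).
assert (L2 : forall z rho, 0 < rho -> is_lim P z (sqrt rho) -> is_lim (fun y => P y ^ 2) z rho).
{ intros z rho Hr L. rewrite <- (sqrt_sqrt rho) by lra.
  apply (is_lim_ext (fun y => P y * P y)). { intros y; ring. }
  now apply (is_lim_mult P P z (sqrt rho) (sqrt rho)). }
assert (LU : forall z W, 0 < density W -> A = density W * (velocity W - s) ->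
  is_lim P z (sqrt (density W)) -> is_lim (fun y => s + A / P y ^ 2) z (velocity W)).
{ intros z W Hr E L. replace (velocity W) with (s + A * / density W) by (rewrite E; field; lra).
  apply (is_lim_plus' (fun _ => s)). { apply is_lim_const. }
  apply (is_lim_scal_l (fun y => / P y ^ 2) A z (/ density W)).
  apply (is_lim_inv _ z (density W)); [now apply L2|]. injection; lra. }
split; [|split; [|split; [|split; [|split; [|split; [|split]]]]]]; trivial.
- apply differentiable_upto_smooth. intros n; apply sm.
- apply differentiable_upto_smooth. intros n.
  apply differentiable_upto_plus; [apply differentiable_upto_const|].
  apply differentiable_upto_mult; [apply differentiable_upto_const|].
  apply differentiable_upto_inv. { intros y. specialize (HP2 y). lra. }
  simpl pow. apply differentiable_upto_mult; [apply sm|].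
  apply differentiable_upto_mult; [apply sm|apply differentiable_upto_const].
- now apply (amplitude_orbit_solves gamma mu k eps s A B P p).
- now apply L2.
- now apply L2.
- apply LU; trivial. now symmetry.
- now apply LU.
Qed.

(** Since c_s^2 = gamma rho^(gamma-1), comparing the speed with c_s amounts to
    comparing the squared flux with gamma rho^(gamma+1). *)
Lemma supersonic_flux gamma rho v : 1 <= gamma -> 0 < rho -> sound_speed gamma rho < v ->
  gamma * Rpower rho (gamma + 1) < (rho * v)^2.
Proof.
intros Hg Hr Hv. rewrite sound_speed_eq in Hv by trivial.
replace (gamma + 1) with (gamma - 1 + INR 2) by (simpl; ring).
rewrite Rpower_plus, Rpower_pow by trivial.
assert (Hc : 0 <= gamma * Rpower rho (gamma - 1)).
{ apply Rmult_le_pos; [lra | left; apply exp_pos]. }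
assert (S := sqrt_pos (gamma * Rpower rho (gamma - 1))).
assert (Q := sqrt_sqrt _ Hc). set (c := sqrt (gamma * Rpower rho (gamma - 1))) in *.
rewrite <- Rmult_assoc, <- Q. replace ((rho * v)^2) with (v * v * rho^2) by ring.
apply Rmult_lt_compat_r; [now apply pow_lt | nra].
Qed.

Lemma subsonic_flux gamma rho v : 1 <= gamma -> 0 < rho -> 0 <= v < sound_speed gamma rho ->
  (rho * v)^2 < gamma * Rpower rho (gamma + 1).
Proof.
intros Hg Hr Hv. rewrite sound_speed_eq in Hv by trivial.
replace (gamma + 1) with (gamma - 1 + INR 2) by (simpl; ring).
rewrite Rpower_plus, Rpower_pow by trivial.
assert (Hc : 0 <= gamma * Rpower rho (gamma - 1)).
{ apply Rmult_le_pos; [lra | left; apply exp_pos]. }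
assert (S := sqrt_pos (gamma * Rpower rho (gamma - 1))).
assert (Q := sqrt_sqrt _ Hc). set (c := sqrt (gamma * Rpower rho (gamma - 1))) in *.
rewrite <- Rmult_assoc, <- Q. replace ((rho * v)^2) with (v * v * rho^2) by ring.
apply Rmult_lt_compat_r; [now apply pow_lt | nra].
Qed.

Theorem corollary2 (gamma mu k eps : R) (Wm Wp : state) (s : R)
    (hgamma : 1 <= gamma) (hmu : 0 < mu) (hk : 0 < k) (heps : 0 < eps)
    (hrhom : 0 < density Wm) (hrhop : 0 < density Wp)
    (hshock :
      (lax_shock gamma family2 Wm Wp s /\ subsonic gamma Wp)
      \/ (lax_shock gamma family1 Wm Wp s /\ subsonic gamma Wm)) :
  exists P U : R -> R, traveling_wave_profile gamma mu k eps s Wm Wp P U.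
Proof.
assert (RH : rankine_hugoniot gamma Wm Wp s) by (destruct hshock as [[[H _] _]|[[H _] _]]; exact H).
destruct RH as [RH1 RH2].
set (A := density Wp * (velocity Wp - s)).
assert (HA : density Wm * (velocity Wm - s) = A) by (unfold A; lra).
set (B := A^2 / (2 * density Wp ^ 2) + enthalpy gamma (density Wp)).
assert (Zp : bernoulli gamma A B (density Wp) = 0) by (unfold bernoulli, B; ring).
assert (Zm : bernoulli gamma A B (density Wm) = 0).
{ unfold bernoulli, B.
  replace (A^2 / (2 * density Wm ^ 2)) with ((velocity Wm - s)^2 / 2) by (rewrite <- HA; field; lra).
  replace (A^2 / (2 * density Wp ^ 2)) with ((velocity Wp - s)^2 / 2) by (unfold A; field; lra).
  lra. }
assert (Hk2 : 0 < k^2) by now apply pow_lt.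
destruct hshock as [[[_ Hlax] Hsub]|[[_ Hlax] Hsub]]; unfold subsonic in Hsub; simpl in Hlax;
  apply Rabs_lt_between in Hsub.
- assert (Hs : 0 < s) by lra.
  assert (Hvm : 0 <= s - velocity Wm).
  { apply Rnot_lt_le. intros Hn.
    assert (0 < s - velocity Wp) by (assert (X := sqrt_pos (density Wp * Derive (enthalpy gamma) (density Wp)));
      fold (sound_speed gamma (density Wp)) in X; lra).
    unfold A in HA. nra. }
  destruct (amplitude_heteroclinic gamma A B (density Wp) (density Wm)) with (k := k) (alpha := 2 * mu * s / k^2)
    as (P & p & HP & H & Lm & Lp); trivial.
  + replace (A^2) with ((density Wp * (s - velocity Wp))^2) by (unfold A; ring).
    apply supersonic_flux; trivial; lra.
  + replace (A^2) with ((density Wm * (s - velocity Wm))^2) by (rewrite <- HA; ring).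
    apply subsonic_flux; trivial; lra.
  + apply Rdiv_lt_0_compat; trivial. apply Rmult_lt_0_compat; lra.
  + exists P, (fun y => s + A / P y ^ 2). now apply (amplitude_orbit_profile gamma mu k eps s B Wm Wp P p).
- (* Reversing [y] turns the negative friction into a positive one and moves the
     subsonic right state, the saddle, to the left. *)
  assert (Hs : s < 0) by lra.
  assert (Hvp : 0 <= velocity Wp - s).
  { apply Rnot_lt_le. intros Hn.
    assert (0 < velocity Wm - s) by (assert (X := sqrt_pos (density Wm * Derive (enthalpy gamma) (density Wm)));
      fold (sound_speed gamma (density Wm)) in X; lra).
    unfold A in HA. nra. }
  destruct (amplitude_heteroclinic gamma A B (density Wm) (density Wp)) with (k := k) (alpha := - (2 * mu * s / k^2))
    as (P & p & HP & H & Lp & Lm); trivial.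
  + rewrite <- HA. apply supersonic_flux; trivial; lra.
  + apply subsonic_flux; trivial; lra.
  + replace (- (2 * mu * s / k^2)) with (2 * mu * (- s) / k^2) by (field; lra).
    apply Rdiv_lt_0_compat; trivial. apply Rmult_lt_0_compat; lra.
  + exists (fun y => P (- y)), (fun y => s + A / P (- y) ^ 2).
    apply (amplitude_orbit_profile gamma mu k eps s B Wm Wp (fun y => P (- y)) (fun y => - p (- y))); trivial.
    * intros y. replace (2 * mu * s / k^2) with (- - (2 * mu * s / k^2)) by ring.
      apply oscillator_reverse, H.
    * apply (is_lim_comp P Ropp m_infty _ p_infty); trivial.
      apply (is_lim_opp (fun t => t) m_infty m_infty), is_lim_id.
      exists 0; intros y _; discriminate.
    * apply (is_lim_comp P Ropp p_infty _ m_infty); trivial.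
      apply (is_lim_opp (fun t => t) p_infty p_infty), is_lim_id.
      exists 0; intros y _; discriminate.
Qed.
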